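(* Let $a$ be a complex number with $\operatorname{Re} a>0$. Then $$\int_0^\infty \frac{\sin 2x}{\cosh ax+\cos 2x}\,\frac{x\,dx}{x^2-\pi^2}=\tan^{-1}\frac2a-\frac{2a}{1+a^2},$$ $$\int_0^\infty \frac{\sin 3x}{\cosh ax+\cos 3x}\,\frac{x\,dx}{x^2-\pi^2}=\tan^{-1}\frac3a-\frac{4+3a^2}{a(4+a^2)},$$ and $$\int_0^\infty \frac{\sin 4x}{\cosh ax+\cos 4x}\,\frac{x\,dx}{x^2-\pi^2}=\tan^{-1}\frac4a-\frac{4a(5+a^2)}{9+10a^2+a^4}.$$
   Context: $\tan^{-1}$ denotes the principal branch of the arctangent. The singularities of the integrands at $x=\pi$ are removable. *)

(* Defs.v *)
From Stdlib Require Import Reals.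
From Coquelicot Require Import Coquelicot.

Open Scope R_scope.

Definition Cexp (z : C) : C :=
  (exp (Re z) * cos (Im z), exp (Re z) * sin (Im z)).

Definition Ccosh (z : C) : C := ((Cexp z + Cexp (- z)) / 2)%C.

(* Principal argument of z <> 0, with values in (-PI, PI].
   The value at z = 0 is meaningless. *)
Definition Carg (z : C) : R :=
  if Rle_dec 0 (Im z) then acos (Re z / Cmod z) else - acos (Re z / Cmod z).

Definition Clog (z : C) : C := (ln (Cmod z), Carg z).

(* Principal branch, with cuts { i t : t real, |t| >= 1 }. *)
Definition Catan (z : C) : C :=
  ((Clog (1 + Ci * z) - Clog (1 - Ci * z)) / (2 * Ci))%C.

(* The integral of f over [0, +oo) is an improper Riemann integral, and the
   relation asserts that it converges.  C is taken as a normed module over R. *)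
Definition is_RInt_0_oo (f : R -> C) (l : C) : Prop :=
  is_RInt_gen (V := C_R_NormedModule) f (at_point 0) (Rbar_locally p_infty) l.

(* The singularity at x = PI is removable when n is an integer >= 2.  The value
   given at that single point by division by zero does not affect the Riemann
   integral. *)
Definition integrand (n : nat) (a : C) (x : R) : C :=
  (sin (INR n * x) / (Ccosh (a * x) + cos (INR n * x))
   * (x / (x ^ 2 - PI ^ 2))%R)%C.

(* Main.v *)
(** For n = 1, put rho_k(x) = int_0^1 k cos(k s x) cos(k pi s) ds
    = (-1)^k sin(k x) x / (x^2 - pi^2).  The geometric expansion
      sin x / (cosh a x + cos x) = 2 sum_(k>=1) (-1)^(k-1) e^(-k a x) sin(k x)
    turns the integrand into -2 sum_k e^(-k a x) rho_k(x): the alternating signs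
    cancel because sin(k (x - pi)) = (-1)^k sin(k x).  Exchanging the integrals,
    int_0^oo e^(-k a x) rho_k(x) dx = int_0^1 cos(k pi s) g(s) ds with
    g(s) = a / (a^2 + s^2), so the integral equals minus twice the sum of the
    cosine coefficients of g, that is int_0^1 g - g(0) = arctan(1/a) - 1/a, by
    convergence of the Fourier series of g at 0.

    For general n, sin(n x) / (cosh a x + cos n x) = i (W(a - i n) - W(a + i n))
    with W(z) = 1 / (1 + e^(-z x)); splitting the difference into steps of 2i
    writes the integrand as a sum of integrands for n = 1 with a replaced by
    a + i m, m = 1 - n, 3 - n, ..., n - 1. *)
Require Import Defs.
From Stdlib Require Import Reals Lra Lia.
From Coquelicot Require Import Coquelicot.

Open Scope R_scope.

(** * Parametric integrals *)

(** No infinite series is manipulated. Since [rho k x] obeys a three-term recurrence in k, the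
    geometric series cut after N terms has an exact remainder in closed form. Its modulus is at most
    a constant times N x e^(-N Re(a) x), up to lower order, and this integrates to O(1/N); the
    factor x, inherited from the vanishing of every rho_k at 0, is what gives decay instead of a
    mere bound. Integrals are also cut at a finite b, so that Fubini is needed only on compact
    rectangles; N is chosen first, then b depending on N. The Fourier series converges at 0 with
    rate O(1/N) because g is even: g(s) - g(0) = s^2 H(s) with H smooth, and s^2 more than cancels
    the zero of the denominator sin(pi s / 2) of the Dirichlet kernel. One integration by parts then
    suffices. The case n = 1 has to be proved for complex a even if only real a is of interest,
    because the reduction of general n shifts a along a vertical line. These shifts preserve Re a >
    0. *)

Lemma continuity_2d_pt_swap (f : R -> R -> R) (x y : R) :
  continuity_2d_pt f x y -> continuity_2d_pt (fun u v => f v u) y x.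
Proof.
  intros H eps; destruct (H eps) as [d Hd].
  exists d; intros u v Hu Hv; now apply Hd.
Qed.

Lemma continuous_section_l (f : R -> R -> R) (x y : R) :
  continuity_2d_pt f x y -> continuous (fun u => f u y) x.
Proof.
  intros H; apply continuity_pt_filterlim, continuity_pt_locally; intros eps.
  destruct (H eps) as [d Hd]; exists d; intros u Hu.
  apply Hd; [exact Hu|].
  rewrite Rminus_diag, Rabs_R0; apply cond_pos.
Qed.

Lemma ex_RInt_section (f : R -> R -> R) (x c d : R) :
  (forall x y, continuity_2d_pt f x y) -> ex_RInt (f x) c d.
Proof.
  intros H; apply (ex_RInt_continuous (V := R_CompleteNormedModule)); intros y _.
  apply (continuous_section_l (fun u v => f v u)), continuity_2d_pt_swap, H.
Qed.

Lemma continuous_RInt_section (f : R -> R -> R) (c d x : R) :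
  (forall x y, continuity_2d_pt f x y) ->
  continuous (fun u => RInt (f u) c d) x.
Proof.
  intros H.
  assert (Hle : forall c d, c <= d -> continuous (fun u => RInt (f u) c d) x).
  { clear c d; intros c d Hcd.
    apply continuity_pt_filterlim, continuity_pt_locally; intros eps.
    (* The [+ 1] covers [c = d] and leaves the strict margin [eps / (d - c + 1)] in the last
       estimate. *)
    assert (Hp : 0 < eps / (d - c + 1)).
    { apply Rdiv_lt_0_compat; [apply cond_pos|lra]. }
    destruct (uniform_continuity_2d_1d' f c d x (fun t _ => H x t) (mkposreal _ Hp))
      as [del Hdel].
    exists del; intros u Hu; simpl in Hdel.
    assert (Hu' : x - del <= u <= x + del).
    { change (Rabs (u - x) < del) in Hu; apply Rabs_def2 in Hu; lra. }
    pose proof (cond_pos del).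
    change (Rabs (minus (RInt (f u) c d) (RInt (f x) c d)) < eps).
    rewrite <- (RInt_minus (V := R_CompleteNormedModule) (f u) (f x) c d)
      by now apply ex_RInt_section.
    apply Rle_lt_trans with ((d - c) * (eps / (d - c + 1))).
    - change (norm (RInt (fun t => minus (f u t) (f x t)) c d)
              <= (d - c) * (eps / (d - c + 1))).
      apply (norm_RInt_le_const (V := R_NormedModule)
               (fun t => minus (f u t) (f x t)) c d); [exact Hcd| |].
      + intros t Ht; apply Rlt_le.
        change (Rabs (f u t - f x t) < eps / (d - c + 1)).
        apply Hdel; try lra.
        rewrite Rminus_diag, Rabs_R0; apply cond_pos.
      + apply (RInt_correct (V := R_CompleteNormedModule)).
        apply (ex_RInt_minus (V := R_NormedModule)); now apply ex_RInt_section.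
    - replace ((d - c) * (eps / (d - c + 1))) with (eps - eps / (d - c + 1))
        by (field; lra).
      lra. }
  destruct (Rle_dec c d) as [Hcd|Hcd]; [now apply Hle|].
  apply continuous_ext with (fun u => opp (RInt (f u) d c)).
  - intros u; apply (opp_RInt_swap (V := R_CompleteNormedModule)).
    now apply ex_RInt_section.
  - apply (continuous_opp (V := R_NormedModule)); apply Hle; lra.
Qed.

(** The upper limit in x is made a variable u: differentiating the iterated integral of [F u] under
    the integral sign gives [RInt (f u) c d], and the fundamental theorem of calculus recovers the
    integral from a to b. *)
Lemma is_RInt_Fubini (f : R -> R -> R) (a b c d : R) :
  (forall x y, continuity_2d_pt f x y) ->
  is_RInt (fun x => RInt (f x) c d) a b
    (RInt (fun y => RInt (fun x => f x y) a b) c d).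
Proof.
  intros H.
  set (F := fun u y => RInt (fun x => f x y) a u).
  assert (HF : forall u y, is_derive (fun u => F u y) u (f u y)).
  { intros u y; apply (is_derive_RInt (V := R_NormedModule) (fun x => f x y) (fun u => F u y) a).
    - exists (mkposreal 1 Rlt_0_1); intros v _; apply (RInt_correct (V := R_CompleteNormedModule)).
      apply (ex_RInt_section (fun y x => f x y)); intros; apply continuity_2d_pt_swap, H.
    - apply continuous_section_l, H. }
  assert (HG : forall u, is_derive (fun u => RInt (F u) c d) u (RInt (f u) c d)).
  { intros u.
    rewrite (RInt_ext (f u) (fun t => Derive (fun u => F u t) u)).
    2:{ intros t _; symmetry; apply is_derive_unique, HF. }
    apply is_derive_RInt_param.
    - exists (mkposreal 1 Rlt_0_1); intros v _ t _; eexists; apply HF.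
    - intros t _; apply continuity_2d_pt_ext with f; [|apply H].
      intros; symmetry; apply is_derive_unique, HF.
    - exists (mkposreal 1 Rlt_0_1); intros v _; apply (ex_RInt_continuous (V := R_CompleteNormedModule)); intros y _.
      apply (continuous_RInt_section (fun y x => f x y)).
      intros; apply continuity_2d_pt_swap, H. }
  replace (RInt (fun y => RInt (fun x => f x y) a b) c d)
    with (minus (RInt (F b) c d) (RInt (F a) c d)).
  - apply (is_RInt_derive (V := R_CompleteNormedModule) (fun u => RInt (F u) c d)).
    + intros x _; apply HG.
    + intros x _; now apply continuous_RInt_section.
  - rewrite (RInt_ext (F a) (fun _ => 0)).
    2:{ intros t _; apply (RInt_point (V := R_CompleteNormedModule)). }
    rewrite RInt_const; change (RInt (F b) c d - (d - c) * 0 = RInt (F b) c d); ring.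
Qed.

(** * Complex functions of a real variable *)

Lemma C_ext (z w : C) : Re z = Re w -> Im z = Im w -> z = w.
Proof. destruct z, w; simpl; now intros -> ->. Qed.

Lemma scal_C_R (x : R) (z : C) : @scal R_AbsRing C_R_NormedModule x z = (RtoC x * z)%C.
Proof.
  apply C_ext; unfold scal; simpl; unfold scal; simpl; unfold mult; simpl; ring.
Qed.

Lemma norm_C_R (z : C) : norm (z : C_R_NormedModule) = Cmod z.
Proof. symmetry; apply Cmod_norm. Qed.

Lemma is_RInt_C (f : R -> C) (a b : R) (l : C) :
  is_RInt (fun x => Re (f x)) a b (Re l) ->
  is_RInt (fun x => Im (f x)) a b (Im l) ->
  is_RInt (V := C_R_NormedModule) f a b l.
Proof.
  intros H1 H2; destruct l as [u v].
  now apply (is_RInt_fct_extend_pair (U := R_NormedModule) (V := R_NormedModule)).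
Qed.

(** Stated by coordinates, so that real differentiation rules apply to each of them directly. *)
Definition is_Cderive (F : R -> C) (x : R) (l : C) : Prop :=
  is_derive (fun t => Re (F t)) x (Re l) /\ is_derive (fun t => Im (F t)) x (Im l).

Definition Ccontinuous (F : R -> C) (x : R) : Prop :=
  continuous (fun t => Re (F t)) x /\ continuous (fun t => Im (F t)) x.

Lemma is_Cderive_continuous (F : R -> C) (x : R) (l : C) :
  is_Cderive F x l -> Ccontinuous F x.
Proof.
  intros [H1 H2]; split; apply (ex_derive_continuous (V := R_NormedModule)); eexists; eassumption.
Qed.

Lemma is_Cderive_eq (F : R -> C) (x : R) (l l' : C) :
  is_Cderive F x l -> l = l' -> is_Cderive F x l'.
Proof. now intros H <-. Qed.

Lemma is_Cderive_const (c : C) (x : R) : is_Cderive (fun _ => c) x 0.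
Proof. split; apply (is_derive_const (V := R_NormedModule)). Qed.

Lemma is_Cderive_RtoC (f : R -> R) (x l : R) :
  is_derive f x l -> is_Cderive (fun t => RtoC (f t)) x l.
Proof. intros H; split; [exact H|apply (is_derive_const (V := R_NormedModule) 0)]. Qed.

Lemma is_Cderive_plus (F G : R -> C) (x : R) (l m : C) :
  is_Cderive F x l -> is_Cderive G x m -> is_Cderive (fun t => F t + G t)%C x (l + m)%C.
Proof.
  intros [H1 H2] [H3 H4]; split; apply (is_derive_plus (V := R_NormedModule)); assumption.
Qed.

Lemma is_Cderive_opp (F : R -> C) (x : R) (l : C) :
  is_Cderive F x l -> is_Cderive (fun t => - F t)%C x (- l)%C.
Proof. intros [H1 H2]; split; apply (is_derive_opp (V := R_NormedModule)); assumption. Qed.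

Lemma is_Cderive_mult (F G : R -> C) (x : R) (l m : C) :
  is_Cderive F x l -> is_Cderive G x m ->
  is_Cderive (fun t => F t * G t)%C x (l * G x + F x * m)%C.
Proof.
  intros [H1 H2] [H3 H4].
  assert (Hc : forall n p : R, mult n p = mult p n) by (intros; apply Rmult_comm).
  split.
  - pose proof (is_derive_minus _ _ _ _ _ (is_derive_mult _ _ _ _ _ H1 H3 Hc)
      (is_derive_mult _ _ _ _ _ H2 H4 Hc)) as H.
    evar_last; [exact H|].
    unfold minus, plus, opp, mult; simpl; unfold Re, Im; simpl; ring.
  - pose proof (is_derive_plus _ _ _ _ _ (is_derive_mult _ _ _ _ _ H1 H4 Hc)
      (is_derive_mult _ _ _ _ _ H2 H3 Hc)) as H.
    evar_last; [exact H|].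
    unfold plus, mult; simpl; unfold Re, Im; simpl; ring.
Qed.

Lemma is_Cderive_inv (F : R -> C) (x : R) (l : C) :
  is_Cderive F x l -> F x <> 0 -> is_Cderive (fun t => / F t)%C x (- l / (F x * F x))%C.
Proof.
  intros [H1 H2] H0.
  assert (Hn : fst (F x) ^ 2 + snd (F x) ^ 2 <> 0).
  { intros E; apply H0; apply C_ext; unfold Re, Im; simpl; nra. }
  (* One real quotient rule serves both coordinates of the inverse: the imaginary part is the
     opposite of the same quotient with f and g exchanged. *)
  assert (Hr : forall f g : R -> R, forall u v, is_derive f x u -> is_derive g x v ->
    f x ^ 2 + g x ^ 2 <> 0 ->
    is_derive (fun t => f t / (f t ^ 2 + g t ^ 2)) x
      ((u * (g x ^ 2 - f x ^ 2) - 2 * f x * g x * v) / (f x ^ 2 + g x ^ 2) ^ 2)).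
  { intros f g u v Hf Hg Hfg; auto_derive.
    - repeat split; try (eexists; eassumption); assumption.
    - replace (Derive (fun t => f t) x) with u by (symmetry; now apply is_derive_unique).
      replace (Derive (fun t => g t) x) with v by (symmetry; now apply is_derive_unique).
      field; exact Hfg. }
  assert (Hn2 : fst (F x) * fst (F x) + snd (F x) * snd (F x) <> 0).
  { intros E; apply Hn; rewrite <- E; ring. }
  split.
  - evar_last; [exact (Hr _ _ _ _ H1 H2 Hn)|].
    simpl; unfold Re, Im; simpl; field.
    split; [|assumption].
    replace (_ + _) with ((fst (F x) ^ 2 + snd (F x) ^ 2) ^ 2) by ring.
    now apply pow_nonzero.
  - apply is_derive_ext with
      (fun t => - (Im (F t) / (Im (F t) ^ 2 + Re (F t) ^ 2))).
    { intros t; unfold Cinv, Re, Im; simpl; rewrite (Rplus_comm (snd _ * _)).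
      unfold Rdiv; ring. }
    evar_last; [apply (is_derive_opp (V := R_NormedModule)); apply (Hr _ _ _ _ H2 H1)|].
    { rewrite Rplus_comm; exact Hn. }
    unfold opp; simpl; unfold Re, Im; simpl; field.
    split; [|now rewrite Rplus_comm].
    replace (_ + _) with ((fst (F x) ^ 2 + snd (F x) ^ 2) ^ 2) by ring.
    now apply pow_nonzero.
Qed.

Lemma Ccontinuous_const (c : C) (x : R) : Ccontinuous (fun _ => c) x.
Proof. split; apply continuous_const. Qed.

Lemma Ccontinuous_RtoC (f : R -> R) (x : R) :
  continuous f x -> Ccontinuous (fun t => RtoC (f t)) x.
Proof. intros H; split; [exact H|apply continuous_const]. Qed.

Lemma Ccontinuous_plus (F G : R -> C) (x : R) :
  Ccontinuous F x -> Ccontinuous G x -> Ccontinuous (fun t => F t + G t)%C x.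
Proof.
  intros [H1 H2] [H3 H4]; split; apply (continuous_plus (V := R_NormedModule)); assumption.
Qed.

Lemma Ccontinuous_opp (F : R -> C) (x : R) :
  Ccontinuous F x -> Ccontinuous (fun t => - F t)%C x.
Proof. intros [H1 H2]; split; apply (continuous_opp (V := R_NormedModule)); assumption. Qed.

Lemma Ccontinuous_mult (F G : R -> C) (x : R) :
  Ccontinuous F x -> Ccontinuous G x -> Ccontinuous (fun t => F t * G t)%C x.
Proof.
  intros [H1 H2] [H3 H4]; split.
  - apply (continuous_minus (V := R_NormedModule)); apply (continuous_mult (K := R_AbsRing)); assumption.
  - apply (continuous_plus (V := R_NormedModule)); apply (continuous_mult (K := R_AbsRing)); assumption.
Qed.

Lemma Ccontinuous_inv (F : R -> C) (x : R) :
  Ccontinuous F x -> F x <> 0 -> Ccontinuous (fun t => / F t)%C x.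
Proof.
  intros [H1 H2] H0.
  assert (Hn : fst (F x) ^ 2 + snd (F x) ^ 2 <> 0).
  { intros E; apply H0; apply C_ext; unfold Re, Im; simpl; nra. }
  assert (Hd : continuous (fun t => / (fst (F t) ^ 2 + snd (F t) ^ 2)) x).
  { apply continuous_comp with (g := Rinv).
    - simpl.
      apply (continuous_plus (V := R_NormedModule) (fun t => fst (F t) * (fst (F t) * 1))
        (fun t => snd (F t) * (snd (F t) * 1)));
        (apply (continuous_mult (K := R_AbsRing)); [assumption|]);
        (apply (continuous_mult (K := R_AbsRing)); [assumption|apply continuous_const]).
    - apply continuity_pt_filterlim, continuity_pt_inv; [apply continuity_pt_id|exact Hn]. }
  split; apply (continuous_mult (K := R_AbsRing)); try assumption.
  now apply (continuous_opp (V := R_NormedModule)).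
Qed.

Lemma is_RInt_Ccontinuous (F : R -> C) (a b : R) :
  (forall x, Rmin a b <= x <= Rmax a b -> Ccontinuous F x) ->
  is_RInt (V := C_R_NormedModule) F a b
    (RInt (fun t => Re (F t)) a b, RInt (fun t => Im (F t)) a b).
Proof.
  intros H; apply is_RInt_C; apply (RInt_correct (V := R_CompleteNormedModule)).
  - apply (ex_RInt_continuous (V := R_CompleteNormedModule) (fun t => Re (F t))).
    intros x Hx; now apply H.
  - apply (ex_RInt_continuous (V := R_CompleteNormedModule) (fun t => Im (F t))).
    intros x Hx; now apply H.
Qed.

Lemma ex_RInt_Ccontinuous (F : R -> C) (a b : R) :
  (forall x, Rmin a b <= x <= Rmax a b -> Ccontinuous F x) ->
  exists l, is_RInt (V := C_R_NormedModule) F a b l.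
Proof. intros H; eexists; now apply is_RInt_Ccontinuous. Qed.

Lemma is_RInt_Cderive (F dF : R -> C) (a b : R) :
  (forall x, Rmin a b <= x <= Rmax a b -> is_Cderive F x (dF x)) ->
  (forall x, Rmin a b <= x <= Rmax a b -> Ccontinuous dF x) ->
  is_RInt (V := C_R_NormedModule) dF a b (F b - F a)%C.
Proof.
  intros H1 H2; apply is_RInt_C.
  - apply (is_RInt_derive (V := R_CompleteNormedModule) (fun t => Re (F t)));
      intros x Hx; [now apply H1|now apply H2].
  - apply (is_RInt_derive (V := R_CompleteNormedModule) (fun t => Im (F t)));
      intros x Hx; [now apply H1|now apply H2].
Qed.

Lemma is_RInt_C_plus (f g : R -> C) (a b : R) (l m : C) :
  is_RInt (V := C_R_NormedModule) f a b l -> is_RInt (V := C_R_NormedModule) g a b m ->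
  is_RInt (V := C_R_NormedModule) (fun x => f x + g x)%C a b (l + m)%C.
Proof. apply (is_RInt_plus (V := C_R_NormedModule)). Qed.

Lemma is_RInt_C_minus (f g : R -> C) (a b : R) (l m : C) :
  is_RInt (V := C_R_NormedModule) f a b l -> is_RInt (V := C_R_NormedModule) g a b m ->
  is_RInt (V := C_R_NormedModule) (fun x => f x - g x)%C a b (l - m)%C.
Proof. apply (is_RInt_minus (V := C_R_NormedModule)). Qed.

Lemma is_RInt_C_mult_r (f : R -> C) (c : C) (a b : R) (l : C) :
  is_RInt (V := C_R_NormedModule) f a b l ->
  is_RInt (V := C_R_NormedModule) (fun x => f x * c)%C a b (l * c)%C.
Proof.
  intros H.
  pose proof (is_RInt_fct_extend_fst (U := R_NormedModule) (V := R_NormedModule) f a b l H) as H1.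
  pose proof (is_RInt_fct_extend_snd (U := R_NormedModule) (V := R_NormedModule) f a b l H) as H2.
  pose proof (is_RInt_scal (V := R_NormedModule)) as Hs.
  apply is_RInt_C.
  - evar_last.
    + apply (is_RInt_ext (V := R_NormedModule)
        (fun x => minus (scal (Re c) (fst (f x))) (scal (Im c) (snd (f x))))).
      { intros x _; change (Re c * fst (f x) - Im c * snd (f x)
          = fst (f x) * Re c - snd (f x) * Im c); ring. }
      apply (is_RInt_minus (V := R_NormedModule)); apply Hs; eassumption.
    + change (Re c * fst l - Im c * snd l = fst l * Re c - snd l * Im c); ring.
  - evar_last.
    + apply (is_RInt_ext (V := R_NormedModule)
        (fun x => plus (scal (Im c) (fst (f x))) (scal (Re c) (snd (f x))))).
      { intros x _; change (Im c * fst (f x) + Re c * snd (f x)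
          = fst (f x) * Im c + snd (f x) * Re c); ring. }
      apply (is_RInt_plus (V := R_NormedModule)); apply Hs; eassumption.
    + change (Im c * fst l + Re c * snd l = fst l * Im c + snd l * Re c); ring.
Qed.

Lemma Cmod_RInt_le (f : R -> C) (g : R -> R) (a b : R) (l : C) (m : R) :
  a <= b -> (forall x, a <= x <= b -> Cmod (f x) <= g x) ->
  is_RInt (V := C_R_NormedModule) f a b l -> is_RInt g a b m -> Cmod l <= m.
Proof.
  intros Hab H Hf Hg; rewrite <- norm_C_R.
  apply (norm_RInt_le (V := C_R_NormedModule) f g a b); try assumption.
  intros x Hx; rewrite norm_C_R; now apply H.
Qed.

(** * The complex exponential *)

Lemma Cexp_plus (z w : C) : Cexp (z + w) = (Cexp z * Cexp w)%C.
Proof.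
  unfold Cexp, Re, Im; simpl; rewrite exp_plus, cos_plus, sin_plus.
  apply C_ext; unfold Re, Im; simpl; ring.
Qed.

Lemma Cexp_RtoC_0 : Cexp 0 = 1%C.
Proof. unfold Cexp; simpl; rewrite exp_0, cos_0, sin_0; apply C_ext; simpl; ring. Qed.

Lemma Cexp_opp_r (z : C) : (Cexp z * Cexp (- z))%C = 1%C.
Proof. rewrite <- Cexp_plus, <- Cexp_RtoC_0; f_equal; ring. Qed.

Lemma Cexp_neq_0 (z : C) : Cexp z <> 0%C.
Proof.
  intros H; pose proof (Cexp_opp_r z) as E; rewrite H, Cmult_0_l in E.
  apply (f_equal Re) in E; simpl in E; lra.
Qed.

Lemma Cmod_Cexp (z : C) : Cmod (Cexp z) = exp (Re z).
Proof.
  unfold Cmod, Cexp; simpl.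
  replace (_ + _) with (exp (Re z) ^ 2 * (Rsqr (sin (Im z)) + Rsqr (cos (Im z))))
    by (unfold Rsqr; ring).
  rewrite sin2_cos2, Rmult_1_r; apply sqrt_pow2, Rlt_le, exp_pos.
Qed.

Lemma Cexp_Ci (t : R) : Cexp (Ci * t) = (cos t + Ci * sin t)%C.
Proof.
  unfold Cexp; simpl.
  replace (0 * t - 1 * 0) with 0 by ring; replace (0 * 0 + 1 * t) with t by ring.
  rewrite exp_0; apply C_ext; simpl; ring.
Qed.

Lemma is_Cderive_Cexp (z : C) (x : R) :
  is_Cderive (fun t => Cexp (- (z * t))) x (- z * Cexp (- (z * x)))%C.
Proof.
  destruct z as [p q]; split; unfold Cexp, Re, Im; simpl; auto_derive; trivial; unfold Rminus; ring.
Qed.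

(** * The kernels rho_k *)

Lemma cos_INR_PI (k : nat) : cos (INR k * PI) = (-1) ^ k.
Proof.
  induction k as [|k IH]; [simpl; rewrite Rmult_0_l; apply cos_0|].
  rewrite S_INR, Rmult_plus_distr_r, Rmult_1_l, neg_cos, IH; simpl; ring.
Qed.

Lemma sin_INR_PI (k : nat) : sin (INR k * PI) = 0.
Proof.
  induction k as [|k IH]; [simpl; rewrite Rmult_0_l; apply sin_0|].
  rewrite S_INR, Rmult_plus_distr_r, Rmult_1_l, neg_sin, IH; ring.
Qed.

Definition kern (k : nat) (x s : R) : R := INR k * (cos (INR k * s * x) * cos (INR k * PI * s)).

(** Being an integral of a continuous kernel, this is continuous at [PI] too, where the quotient
    formula divides by zero. It is the quotient with its singularity removed. *)
Definition rho (k : nat) (x : R) : R := RInt (kern k x) 0 1.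

Lemma continuity_2d_kern (k : nat) (x s : R) : continuity_2d_pt (kern k) x s.
Proof.
  unfold kern.
  apply (continuity_2d_pt_mult (fun _ _ => INR k)
    (fun x s => cos (INR k * s * x) * cos (INR k * PI * s)));
    [apply continuity_2d_pt_const|].
  apply (continuity_2d_pt_mult (fun x s => cos (INR k * s * x)) (fun x s => cos (INR k * PI * s))).
  - apply (continuity_1d_2d_pt_comp cos (fun x s => INR k * s * x)).
    + apply continuity_cos.
    + apply (continuity_2d_pt_mult (fun x s => INR k * s) (fun x s => x)).
      * apply (continuity_2d_pt_mult (fun x s => INR k) (fun x s => s)).
        -- apply continuity_2d_pt_const.
        -- apply continuity_2d_pt_id2.
      * apply continuity_2d_pt_id1.
  - apply (continuity_1d_2d_pt_comp cos (fun x s => INR k * PI * s)).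
    + apply continuity_cos.
    + apply (continuity_2d_pt_mult (fun x s => INR k * PI) (fun x s => s)).
      * apply continuity_2d_pt_const.
      * apply continuity_2d_pt_id2.
Qed.

Lemma continuous_rho (k : nat) (x : R) : continuous (rho k) x.
Proof. apply continuous_RInt_section, continuity_2d_kern. Qed.

Lemma rho_closed (k : nat) (x : R) : 0 <= x -> x <> PI ->
  rho k x = (-1) ^ k * sin (INR k * x) * (x / (x ^ 2 - PI ^ 2)).
Proof.
  intros Hx Hpi; pose proof PI_RGT_0 as HP.
  assert (H1 : x - PI <> 0) by lra.
  assert (H2 : x + PI <> 0) by lra.
  (* Primitive of the kernel after turning the product of cosines into a sum. *)
  set (A := fun s => / 2 * (sin (INR k * (x - PI) * s) / (x - PI)
                            + sin (INR k * (x + PI) * s) / (x + PI))).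
  unfold rho; rewrite (is_RInt_unique (V := R_CompleteNormedModule) _ _ _ (minus (A 1) (A 0))).
  - change (A 1 - A 0 = (-1) ^ k * sin (INR k * x) * (x / (x ^ 2 - PI ^ 2))).
    unfold A; rewrite !Rmult_0_r, !Rmult_1_r, sin_0.
    rewrite (Rmult_minus_distr_l (INR k)), (Rmult_plus_distr_l (INR k)), sin_minus, sin_plus.
    rewrite cos_INR_PI, sin_INR_PI.
    field; repeat split; try assumption.
    replace (x ^ 2 - PI ^ 2) with ((x - PI) * (x + PI)) by ring.
    now apply Rmult_integral_contrapositive.
  - apply (is_RInt_derive (V := R_CompleteNormedModule) A).
    + intros s _; unfold A, kern; auto_derive; [trivial|].
      replace (INR k * (x - PI) * s) with (INR k * s * x - INR k * PI * s) by ring.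
      replace (INR k * (x + PI) * s) with (INR k * s * x + INR k * PI * s) by ring.
      rewrite cos_minus, cos_plus; field; split; assumption.
    + intros s _; apply (continuous_section_l (fun s x => kern k x s)).
      apply continuity_2d_pt_swap, continuity_2d_kern.
Qed.

Lemma rho_0 (x : R) : rho 0 x = 0.
Proof.
  unfold rho; rewrite (RInt_ext _ (fun _ => 0)).
  - rewrite RInt_const; apply Rmult_0_r.
  - intros s _; unfold kern; simpl; ring.
Qed.

(** For x <= 1 the closed form supplies the factor x, as PI^2 - x^2 >= 1 there; for x > 1 the
    trivial bound k on the kernel is enough. *)
Lemma rho_bound (k : nat) (x : R) : 0 <= x -> Rabs (rho k x) <= INR k * x.
Proof.
  intros Hx; pose proof PI2_1 as HP.
  destruct k as [|k].
  { rewrite rho_0, Rabs_R0; simpl; lra. }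
  assert (Hk : 1 <= INR (S k)) by (rewrite S_INR; pose proof (pos_INR k); lra).
  destruct (Rle_dec x 1) as [H1|H1].
  - rewrite rho_closed by lra.
    assert (Hd : 1 <= PI ^ 2 - x ^ 2) by nra.
    replace (x / (x ^ 2 - PI ^ 2)) with (- (x / (PI ^ 2 - x ^ 2))) by (field; lra).
    rewrite !Rabs_mult, <- RPow_abs, Rabs_Ropp, Rabs_m1, pow1, Rmult_1_l.
    rewrite (Rabs_pos_eq (x / _)).
    2:{ apply Rmult_le_pos; [exact Hx|]; apply Rlt_le, Rinv_0_lt_compat; lra. }
    assert (Hs : Rabs (sin (INR (S k) * x)) <= 1) by (apply Rabs_le, SIN_bound).
    assert (Hq : x / (PI ^ 2 - x ^ 2) <= x).
    { apply Rle_div_l; nra. }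
    pose proof (Rabs_pos (sin (INR (S k) * x))).
    assert (0 <= x / (PI ^ 2 - x ^ 2)).
    { apply Rmult_le_pos; [exact Hx|]; apply Rlt_le, Rinv_0_lt_compat; lra. }
    apply Rle_trans with (1 * x); [apply Rmult_le_compat; assumption|].
    apply Rmult_le_compat_r; assumption.
  - apply Rle_trans with ((1 - 0) * INR (S k)); [|nra].
    apply (norm_RInt_le_const (V := R_NormedModule) (kern (S k) x) 0 1); [lra| |].
    + intros s _; change (Rabs (kern (S k) x s) <= INR (S k)).
      unfold kern; rewrite !Rabs_mult, (Rabs_pos_eq (INR _)) by apply pos_INR.
      assert (Hs : forall t, 0 <= Rabs (cos t) <= 1).
      { intros t; split; [apply Rabs_pos|apply Rabs_le, COS_bound]. }
      pose proof (Hs (INR (S k) * s * x)); pose proof (Hs (INR (S k) * PI * s)).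
      apply Rle_trans with (INR (S k) * 1); [|lra].
      apply Rmult_le_compat_l; [lra|nra].
    + apply (RInt_correct (V := R_CompleteNormedModule)), ex_RInt_section, continuity_2d_kern.
Qed.

Lemma rho_PI (k : nat) : rho k PI = INR k / 2.
Proof.
  destruct k as [|k]; [rewrite rho_0; simpl; field|].
  set (K := INR (S k) * PI).
  assert (HK : K <> 0).
  { apply Rmult_integral_contrapositive; split; [apply not_0_INR; lia|apply PI_neq0]. }
  set (A := fun s => INR (S k) / 2 * (s + sin (K * s) * cos (K * s) / K)).
  apply is_RInt_unique; evar_last.
  - apply (is_RInt_derive (V := R_CompleteNormedModule) A (kern (S k) PI)).
    + intros s _; unfold A, kern; auto_derive; [trivial|].
      replace (INR (S k) * s * PI) with (K * s) by (unfold K; ring).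
      fold K; pose proof (sin2_cos2 (K * s)) as E; unfold Rsqr in E.
      transitivity (INR (S k) / 2 * ((sin (K * s) * sin (K * s) + cos (K * s) * cos (K * s))
        + cos (K * s) * cos (K * s) - sin (K * s) * sin (K * s))); [rewrite E|]; unfold INR; field; exact HK.
    + intros s _; apply (continuous_section_l (fun s x => kern (S k) x s)).
      apply continuity_2d_pt_swap, continuity_2d_kern.
  - change (A 1 - A 0 = INR (S k) / 2); unfold A, K.
    rewrite Rmult_1_r, Rmult_0_r, sin_0, sin_INR_PI; field; split; [apply PI_neq0|apply not_0_INR; lia].
Qed.

Lemma rho_rec (k : nat) (x : R) : 0 <= x ->
  rho (S (S k)) x + rho k x + 2 * cos x * rho (S k) x = 0.
Proof.
  intros Hx; destruct (Req_dec x PI) as [->|Hpi].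
  - rewrite !rho_PI, cos_PI, !S_INR; field.
  - rewrite !rho_closed by assumption; rewrite !S_INR.
    replace ((INR k + 1 + 1) * x) with ((INR k + 1) * x + x) by ring.
    replace (INR k * x) with ((INR k + 1) * x - x) by ring.
    rewrite sin_plus, sin_minus; simpl; ring.
Qed.

(** A weak form of Jordan's inequality. Up to the angle PI/3 the slope of sin is at least 1/2;
    beyond it sin is at least sin(PI/6) = 1/2. *)
Lemma sin_lower_bound (s : R) : 0 <= s <= 1 -> s / 2 <= sin (PI / 2 * s).
Proof.
  intros Hs; pose proof PI2_1 as HP; pose proof PI_4 as HP4.
  destruct (Rle_dec (PI / 2 * s) (PI / 3)) as [H|H].
  - destruct (MVT_cor4 sin cos 0 (mkposreal _ PI_RGT_0)) with (b := PI / 2 * s)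
      as [c [Hc1 Hc2]].
    + intros c _; apply is_derive_Reals, derivable_pt_lim_sin.
    + rewrite Rminus_0_r; simpl; rewrite Rabs_pos_eq; nra.
    + rewrite sin_0, !Rminus_0_r in Hc1; rewrite Hc1.
      rewrite !Rminus_0_r, (Rabs_pos_eq (PI / 2 * s)) in Hc2 by nra.
      (* The mean value theorem used here bounds only the absolute value of [c], so evenness of cos
         is needed. *)
      assert (Hcos : 1 / 2 <= cos (Rabs c)).
      { rewrite <- cos_PI3; pose proof (Rabs_pos c); apply cos_decr_1; lra. }
      assert (Hcc : cos (Rabs c) = cos c).
      { unfold Rabs; destruct (Rcase_abs c); [apply cos_neg|reflexivity]. }
      rewrite Hcc in Hcos.
      apply Rle_trans with (1 / 2 * (PI / 2 * s)); [nra|].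
      apply Rmult_le_compat_r; [nra|exact Hcos].
  - assert (1 / 2 <= sin (PI / 2 * s)); [|lra].
    rewrite <- sin_PI6; apply sin_incr_1; nra.
Qed.

(** * Laplace transforms of the kernels *)

(** Only the weight [W] is complex and it depends on x alone, so each coordinate is a real exchange
    for the kernel w(x) K(x, s). *)
Lemma is_RInt_C_Fubini (W J : R -> C) (K : R -> R -> R) (a b c d : R) (l : C) :
  (forall x, Ccontinuous W x) -> (forall x s, continuity_2d_pt K x s) ->
  (forall s, is_RInt (V := C_R_NormedModule) (fun x => W x * K x s)%C a b (J s)) ->
  is_RInt (V := C_R_NormedModule) J c d l ->
  is_RInt (V := C_R_NormedModule) (fun x => W x * RInt (K x) c d)%C a b l.
Proof.
  intros HW HK HJ Hl.
  assert (Hw : forall w : R -> R, (forall x, continuous w x) ->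
    is_RInt (fun x => w x * RInt (K x) c d) a b
      (RInt (fun s => RInt (fun x => w x * K x s) a b) c d)).
  { intros w Hw.
    apply (is_RInt_ext (V := R_NormedModule) (fun x => RInt (fun s => w x * K x s) c d)).
    - intros x _; apply (RInt_scal (V := R_CompleteNormedModule) (K x) c d (w x)).
      now apply ex_RInt_section.
    - apply (is_RInt_Fubini (fun x s => w x * K x s)).
      intros x s; apply (continuity_2d_pt_mult (fun x s => w x) K); [|apply HK].
      apply (continuity_1d_2d_pt_comp w (fun x s => x)).
      + apply continuity_pt_filterlim, Hw.
      + apply continuity_2d_pt_id1. }
  pose proof (is_RInt_fct_extend_fst (U := R_NormedModule) (V := R_NormedModule) J c d l Hl) as H1.
  pose proof (is_RInt_fct_extend_snd (U := R_NormedModule) (V := R_NormedModule) J c d l Hl) as H2.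
  apply is_RInt_C.
  - apply (is_RInt_ext (V := R_NormedModule) (fun x => Re (W x) * RInt (K x) c d)).
    { intros x _; simpl; unfold Re; ring. }
    replace (Re l) with (RInt (fun s => RInt (fun x => Re (W x) * K x s) a b) c d);
      [apply Hw; intros; apply HW|].
    apply (is_RInt_unique (V := R_CompleteNormedModule)).
    apply (is_RInt_ext (V := R_NormedModule) (fun s => fst (J s))); [|exact H1].
    intros s _; symmetry; apply (is_RInt_unique (V := R_CompleteNormedModule)).
    apply (is_RInt_ext (V := R_NormedModule) (fun x => fst (W x * K x s)%C)).
    { intros x _; simpl; unfold Re; ring. }
    now apply (is_RInt_fct_extend_fst (U := R_NormedModule) (V := R_NormedModule)).
  - apply (is_RInt_ext (V := R_NormedModule) (fun x => Im (W x) * RInt (K x) c d)).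
    { intros x _; simpl; unfold Im; ring. }
    replace (Im l) with (RInt (fun s => RInt (fun x => Im (W x) * K x s) a b) c d);
      [apply Hw; intros; apply HW|].
    apply (is_RInt_unique (V := R_CompleteNormedModule)).
    apply (is_RInt_ext (V := R_NormedModule) (fun s => snd (J s))); [|exact H2].
    intros s _; symmetry; apply (is_RInt_unique (V := R_CompleteNormedModule)).
    apply (is_RInt_ext (V := R_NormedModule) (fun x => snd (W x * K x s)%C)).
    { intros x _; simpl; unfold Im; ring. }
    now apply (is_RInt_fct_extend_snd (U := R_NormedModule) (V := R_NormedModule)).
Qed.

Lemma Re_pos_neq_0 (z : C) : 0 < Re z -> z <> 0%C.
Proof. intros H ->; simpl in H; lra. Qed.

Lemma Re_le_Cmod (z : C) : Re z <= Cmod z.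
Proof. eapply Rle_trans; [apply Rle_abs|apply re_le_Cmod]. Qed.

Lemma Re_minus_Ci (a : C) (s : R) : Re (a - Ci * s)%C = Re a.
Proof. destruct a; simpl; ring. Qed.

Lemma Re_plus_Ci (a : C) (s : R) : Re (a + Ci * s)%C = Re a.
Proof. destruct a; simpl; ring. Qed.

Lemma cos_Cexp (t : R) : RtoC (2 * cos t) = (Cexp (Ci * t) + Cexp (- (Ci * t)))%C.
Proof.
  replace (- (Ci * t))%C with (Ci * (- t)%R)%C by (rewrite RtoC_opp; ring).
  rewrite !Cexp_Ci, cos_neg, sin_neg; apply C_ext; simpl; ring.
Qed.

Section Laplace.

Variable a : C.
Hypothesis Ha : 0 < Re a.

Definition gfun (s : R) : C := (a / (a * a + s * s))%C.

Lemma am_neq_0 (s : R) : (a - Ci * s <> 0)%C.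
Proof. apply Re_pos_neq_0; now rewrite Re_minus_Ci. Qed.

Lemma ap_neq_0 (s : R) : (a + Ci * s <> 0)%C.
Proof. apply Re_pos_neq_0; now rewrite Re_plus_Ci. Qed.

Lemma sqr_plus_sqr_factor (s : R) : (a * a + s * s)%C = ((a - Ci * s) * (a + Ci * s))%C.
Proof. apply C_ext; simpl; ring. Qed.

Lemma sqr_plus_sqr_neq_0 (s : R) : (a * a + s * s <> 0)%C.
Proof. rewrite sqr_plus_sqr_factor; apply Cmult_neq_0; [apply am_neq_0|apply ap_neq_0]. Qed.

Lemma gfun_split (s : R) : gfun s = (/ 2 * (/ (a - Ci * s) + / (a + Ci * s)))%C.
Proof.
  pose proof (am_neq_0 s); pose proof (ap_neq_0 s).
  unfold gfun; rewrite sqr_plus_sqr_factor.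
  field; repeat split; try assumption.
Qed.

Definition expw (k : nat) (x : R) : C := Cexp (- (INR k * a * x)).

(** For k >= 1 this is the integral over [b, oo) of [expw k x * kern k x s]. The factor k in [kern]
    cancels the 1/k produced by integrating the exponentials, so the formula involves no division by
    k and the next lemma also holds for k = 0. *)
Definition laplace_tail (k : nat) (b s : R) : C :=
  (cos (INR k * PI * s) *
   (/ 2 * (Cexp (- (INR k * (a - Ci * s) * b)) / (a - Ci * s)
           + Cexp (- (INR k * (a + Ci * s) * b)) / (a + Ci * s))))%C.

Lemma is_RInt_expw_kern (k : nat) (b s : R) :
  is_RInt (V := C_R_NormedModule) (fun x => expw k x * kern k x s)%C 0 b
    (cos (INR k * PI * s) * gfun s - laplace_tail k b s)%C.
Proof.
  pose proof (am_neq_0 s) as Hm; pose proof (ap_neq_0 s) as Hp.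
  evar_last.
  - apply (is_RInt_Cderive (fun x => - laplace_tail k x s)%C).
    + intros x _; unfold laplace_tail.
      eapply is_Cderive_eq.
      * apply is_Cderive_opp, is_Cderive_mult; [apply is_Cderive_const|].
        apply is_Cderive_mult; [apply is_Cderive_const|].
        apply is_Cderive_plus; (apply is_Cderive_mult; [|apply is_Cderive_const]);
        apply is_Cderive_Cexp.
      * unfold expw, kern.
        replace (- (INR k * (a - Ci * s) * x))%C
          with (- (INR k * a * x) + Ci * (INR k * s * x)%R)%C by (rewrite !RtoC_mult; ring).
        replace (- (INR k * (a + Ci * s) * x))%C
          with (- (INR k * a * x) + - (Ci * (INR k * s * x)%R))%C by (rewrite !RtoC_mult; ring).
        rewrite !Cexp_plus.
        replace (INR k * (cos (INR k * s * x) * cos (INR k * PI * s)))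
          with (INR k * cos (INR k * PI * s) * / 2 * (2 * cos (INR k * s * x))) by field.
        rewrite (RtoC_mult _ (2 * _)), cos_Cexp, !RtoC_mult, RtoC_inv by lra.
        field; repeat split; assumption.
    + intros x _; apply Ccontinuous_mult.
      * eapply is_Cderive_continuous, is_Cderive_Cexp.
      * apply Ccontinuous_RtoC, (continuous_section_l (kern k)), continuity_2d_kern.
  - unfold laplace_tail; rewrite gfun_split.
    rewrite !Cmult_0_r.
    replace (- 0)%C with (RtoC 0) by ring; rewrite Cexp_RtoC_0.
    field; repeat split; assumption.
Qed.

Lemma Cmod_inv_le (z : C) : Re a <= Cmod z -> Cmod (/ z) <= / Re a.
Proof.
  intros H; rewrite Cmod_inv; [now apply Rinv_le_contravar|].
  apply Cmod_gt_0; lra.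
Qed.

(** Both a - i s and a + i s have real part Re a, which fixes the modulus of the exponentials and
    bounds the denominators from below, uniformly in s. *)
Lemma Cmod_laplace_tail (k : nat) (b s : R) :
  Cmod (laplace_tail k b s) <= exp (- (INR k * Re a * b)) / Re a.
Proof.
  unfold laplace_tail.
  rewrite !Cmod_mult, Cmod_R.
  assert (Ht : forall z : C, Re z = Re a ->
    Cmod (Cexp (- (INR k * z * b)) / z) <= exp (- (INR k * Re a * b)) / Re a).
  { intros z Hz; unfold Cdiv; rewrite Cmod_mult, Cmod_Cexp.
    replace (Re (- (INR k * z * b))%C) with (- (INR k * Re a * b))
      by (rewrite <- Hz; destruct z; simpl; ring).
    apply Rmult_le_compat_l; [apply Rlt_le, exp_pos|].
    apply Cmod_inv_le; rewrite <- Hz; apply Re_le_Cmod. }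
  pose proof (Ht _ (Re_minus_Ci a s)) as H1.
  pose proof (Ht _ (Re_plus_Ci a s)) as H2.
  pose proof (Cmod_triangle (Cexp (- (INR k * (a - Ci * s) * b)) / (a - Ci * s))
    (Cexp (- (INR k * (a + Ci * s) * b)) / (a + Ci * s))) as H3.
  assert (Hc : Rabs (cos (INR k * PI * s)) <= 1) by apply Rabs_le, COS_bound.
  replace (Cmod (/ 2)) with (/ 2).
  2:{ rewrite <- RtoC_inv, Cmod_R, Rabs_pos_eq by lra; reflexivity. }
  pose proof (Rabs_pos (cos (INR k * PI * s))).
  match goal with |- _ * (_ * ?t) <= _ => set (T := t) in *; assert (0 <= T) by apply Cmod_ge_0 end.
  nra.
Qed.

Lemma Ccontinuous_am (s : R) : Ccontinuous (fun s : R => a - Ci * s)%C s.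
Proof.
  apply Ccontinuous_plus; [apply Ccontinuous_const|].
  apply Ccontinuous_opp, Ccontinuous_mult; [apply Ccontinuous_const|].
  apply Ccontinuous_RtoC, continuous_id.
Qed.

Lemma Ccontinuous_ap (s : R) : Ccontinuous (fun s : R => a + Ci * s)%C s.
Proof.
  apply Ccontinuous_plus; [apply Ccontinuous_const|].
  apply Ccontinuous_mult; [apply Ccontinuous_const|].
  apply Ccontinuous_RtoC, continuous_id.
Qed.

Lemma continuous_cos_lin (c s : R) : continuous (fun s => cos (c * s)) s.
Proof. apply (ex_derive_continuous (V := R_NormedModule)); auto_derive; trivial. Qed.

Lemma Ccontinuous_cos_gfun (k : nat) (s : R) :
  Ccontinuous (fun s => cos (INR k * PI * s) * gfun s)%C s.
Proof.
  apply Ccontinuous_mult; [apply Ccontinuous_RtoC, continuous_cos_lin|].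
  apply Ccontinuous_mult; [apply Ccontinuous_const|].
  apply Ccontinuous_inv; [|apply sqr_plus_sqr_neq_0].
  apply Ccontinuous_plus; [apply Ccontinuous_const|].
  apply Ccontinuous_mult; apply Ccontinuous_RtoC, continuous_id.
Qed.

Lemma Ccontinuous_Cexp (F : R -> C) (x : R) :
  Ccontinuous F x -> Ccontinuous (fun t => Cexp (F t)) x.
Proof.
  intros [H1 H2].
  assert (He : continuous (fun t => exp (Re (F t))) x)
    by (apply continuous_comp; [exact H1|apply continuous_exp]).
  split; apply (continuous_mult (K := R_AbsRing)); try exact He;
    apply continuous_comp; try exact H2; [apply continuous_cos|apply continuous_sin].
Qed.

Lemma Ccontinuous_laplace_tail (k : nat) (b s : R) : Ccontinuous (laplace_tail k b) s.
Proof.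
  assert (He : forall F : R -> C, Ccontinuous F s ->
    Ccontinuous (fun s => Cexp (- (INR k * F s * b)))%C s).
  { intros F HF; apply Ccontinuous_Cexp, Ccontinuous_opp.
    apply Ccontinuous_mult; [|apply Ccontinuous_const].
    apply Ccontinuous_mult; [apply Ccontinuous_const|exact HF]. }
  apply Ccontinuous_mult; [apply Ccontinuous_RtoC, continuous_cos_lin|].
  apply Ccontinuous_mult; [apply Ccontinuous_const|].
  apply Ccontinuous_plus; apply Ccontinuous_mult.
  - apply (He (fun s => a - Ci * s)%C), Ccontinuous_am.
  - apply Ccontinuous_inv; [apply Ccontinuous_am|apply am_neq_0].
  - apply (He (fun s => a + Ci * s)%C), Ccontinuous_ap.
  - apply Ccontinuous_inv; [apply Ccontinuous_ap|apply ap_neq_0].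
Qed.

(** The Laplace transform of rho_k truncated at b differs from the cosine coefficient [c] of g by
    the tail integrated over s. *)
Lemma is_RInt_expw_rho (k : nat) (b : R) (c : C) :
  is_RInt (V := C_R_NormedModule) (fun s => cos (INR k * PI * s) * gfun s)%C 0 1 c ->
  exists l, is_RInt (V := C_R_NormedModule) (fun x => expw k x * rho k x)%C 0 b l
    /\ Cmod (l - c) <= exp (- (INR k * Re a * b)) / Re a.
Proof.
  intros Hc.
  destruct (ex_RInt_Ccontinuous (laplace_tail k b) 0 1) as [e He];
    [intros; apply Ccontinuous_laplace_tail|].
  exists (c - e)%C; split.
  - apply (is_RInt_C_Fubini (expw k) (fun s => cos (INR k * PI * s) * gfun s - laplace_tail k b s)%C).
    + intros x; eapply is_Cderive_continuous, is_Cderive_Cexp.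
    + apply continuity_2d_kern.
    + apply is_RInt_expw_kern.
    + now apply is_RInt_C_minus.
  - replace (c - e - c)%C with (- e)%C by ring; rewrite Cmod_opp.
    apply (Cmod_RInt_le (laplace_tail k b)
      (fun _ => exp (- (INR k * Re a * b)) / Re a) 0 1); [lra| |exact He|].
    + intros; apply Cmod_laplace_tail.
    + evar_last; [apply (is_RInt_const (V := R_NormedModule))|].
      unfold scal; simpl; unfold mult; simpl; ring.
Qed.

End Laplace.

(** * The Dirichlet kernel *)

Fixpoint dirichlet (N : nat) (s : R) : R :=
  match N with
  | O => 1
  | S n => dirichlet n s + 2 * cos (INR (S n) * PI * s)
  end.

(** The closed form of the Dirichlet kernel of period 2, kept as a product so that it holds at s =
    0. *)
Lemma dirichlet_sin (N : nat) (s : R) :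
  dirichlet N s * sin (PI / 2 * s) = sin ((INR N + / 2) * PI * s).
Proof.
  induction N as [|N IH].
  - simpl; rewrite Rmult_1_l; f_equal; field.
  - change (dirichlet (S N) s) with (dirichlet N s + 2 * cos (INR (S N) * PI * s)).
    rewrite Rmult_plus_distr_r, IH, S_INR.
    replace ((INR N + 1 + / 2) * PI * s) with ((INR N + 1) * PI * s + PI / 2 * s) by field.
    replace ((INR N + / 2) * PI * s) with ((INR N + 1) * PI * s - PI / 2 * s) by field.
    rewrite sin_plus, sin_minus; ring.
Qed.

Lemma continuous_dirichlet (N : nat) (s : R) : continuous (dirichlet N) s.
Proof.
  induction N as [|N IH]; [apply continuous_const|].
  apply (continuous_plus (V := R_NormedModule)); [exact IH|].
  apply (continuous_mult (K := R_AbsRing)); [apply continuous_const|apply continuous_cos_lin].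
Qed.

Lemma is_RInt_C_ext (f g : R -> C) (a b : R) (l : C) :
  (forall x, Rmin a b < x < Rmax a b -> f x = g x) ->
  is_RInt (V := C_R_NormedModule) f a b l -> is_RInt (V := C_R_NormedModule) g a b l.
Proof. apply (is_RInt_ext (V := C_R_NormedModule)). Qed.

Lemma is_RInt_C_const (c : C) (a b : R) :
  is_RInt (V := C_R_NormedModule) (fun _ => c) a b (RtoC (b - a) * c)%C.
Proof.
  rewrite <- scal_C_R; apply (is_RInt_const (V := C_R_NormedModule)).
Qed.

Section DirichletDecay.

Variables (H dH : R -> C) (M : R).
Hypothesis HdH : forall s, is_Cderive H s (dH s).
Hypothesis Hcont : forall s, Ccontinuous dH s.
Hypothesis HM : forall s, 0 <= s <= 1 -> Cmod (H s) <= M /\ Cmod (dH s) <= M.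

(** The amplitude left when s^2 times the Dirichlet kernel is written as amplitude times sin((N +
    1/2) pi s). It behaves like 2 s / pi near 0, so it and its derivative are bounded on (0, 1]. *)
Definition ratio (s : R) : R := s ^ 2 / sin (PI / 2 * s).

Definition dratio (s : R) : R :=
  2 * s / sin (PI / 2 * s) - s ^ 2 * (PI / 2) * cos (PI / 2 * s) / sin (PI / 2 * s) ^ 2.

Lemma sin_half_pos (s : R) : 0 < s <= 1 -> 0 < sin (PI / 2 * s).
Proof. intros Hs; pose proof (sin_lower_bound s); lra. Qed.

Lemma ratio_bound (s : R) : 0 < s <= 1 -> 0 <= ratio s <= 2 * s.
Proof.
  intros Hs; pose proof (sin_half_pos s Hs); pose proof (sin_lower_bound s).
  unfold ratio; split.
  - apply Rlt_le, Rdiv_lt_0_compat; nra.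
  - apply Rle_div_l; nra.
Qed.

(** With q = s / sin(pi s / 2) <= 2 and pi <= 4, the two terms are at most 2 q <= 4 and q^2 pi / 2
    <= 8. *)
Lemma dratio_bound (s : R) : 0 < s <= 1 -> Rabs (dratio s) <= 12.
Proof.
  intros Hs; pose proof (sin_half_pos s Hs) as H0; pose proof (sin_lower_bound s) as H1.
  pose proof PI_4 as HP; pose proof PI_RGT_0.
  assert (Hq : 0 <= s / sin (PI / 2 * s) <= 2).
  { split; [apply Rlt_le, Rdiv_lt_0_compat; lra|apply Rle_div_l; lra]. }
  unfold dratio.
  replace (_ - _) with (2 * (s / sin (PI / 2 * s))
    - (s / sin (PI / 2 * s)) ^ 2 * (PI / 2) * cos (PI / 2 * s)) by (field; lra).
  set (q := s / sin (PI / 2 * s)) in *; pose proof (COS_bound (PI / 2 * s)) as Hc; set (c := cos _) in *.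
  assert (Hq2 : 0 <= q ^ 2 <= 4) by (split; nra).
  assert (0 <= q ^ 2 * (PI / 2) <= 8).
  { split; [apply Rmult_le_pos; lra|]; apply Rle_trans with (4 * 2); [apply Rmult_le_compat; lra|lra]. }
  set (r := q ^ 2 * (PI / 2)) in *.
  apply Rabs_le; split; nra.
Qed.

Lemma is_derive_ratio_cos (w s : R) : w <> 0 -> 0 < s <= 1 ->
  is_derive (fun s => - (ratio s * cos (w * s) / w)) s
    (ratio s * sin (w * s) - dratio s * cos (w * s) / w).
Proof.
  intros Hw Hs; pose proof (sin_half_pos s Hs).
  unfold ratio, dratio; auto_derive; [lra|field; lra].
Qed.

(* Integration by parts of ratio * H * sin (w s), away from s = 0 where ratio is a
   junk quotient. *)
Lemma dirichlet_decay_cut (N : nat) (e : R) (l : C) : 0 < e < 1 ->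
  is_RInt (V := C_R_NormedModule) (fun s => dirichlet N s * (s ^ 2 * H s))%C e 1 l ->
  Cmod l <= 18 * M / (INR N + / 2).
Proof.
  intros He Hl; pose proof (pos_INR N) as HN; pose proof PI2_1 as HP.
  set (w := (INR N + / 2) * PI).
  assert (Hw : INR N + / 2 <= w) by (unfold w; nra).
  assert (HM0 : 0 <= M).
  { destruct (HM 1) as [HM1 _]; [lra|]; pose proof (Cmod_ge_0 (H 1)); lra. }
  set (F := fun s => (RtoC (- (ratio s * cos (w * s) / w)) * H s)%C).
  set (dF := fun s => (RtoC (ratio s * sin (w * s) - dratio s * cos (w * s) / w) * H s
     + RtoC (- (ratio s * cos (w * s) / w)) * dH s)%C).
  assert (HF : is_RInt (V := C_R_NormedModule) dF e 1 (F 1 - F e)%C).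
  { apply is_RInt_Cderive; rewrite Rmin_left, Rmax_right by lra; intros s Hs.
    - apply (is_Cderive_mult (fun s => RtoC (- (ratio s * cos (w * s) / w)))); [|apply HdH].
      apply (is_Cderive_RtoC (fun s => - (ratio s * cos (w * s) / w))).
      apply is_derive_ratio_cos; lra.
    - assert (Hsn : 0 < sin (PI / 2 * s)) by (apply sin_half_pos; lra).
      apply Ccontinuous_plus; apply Ccontinuous_mult.
      + apply Ccontinuous_RtoC, (ex_derive_continuous (V := R_NormedModule)).
        unfold ratio, dratio; auto_derive; repeat split; try (apply Rgt_not_eq; nra); lra.
      + eapply is_Cderive_continuous, HdH.
      + apply Ccontinuous_RtoC, (ex_derive_continuous (V := R_NormedModule)).
        unfold ratio; auto_derive; repeat split; try (apply Rgt_not_eq; nra); lra.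
      + apply Hcont. }
  assert (HFb : forall s, 0 < s <= 1 -> Cmod (F s) <= 2 * M / w).
  { intros s Hs; unfold F; rewrite Cmod_mult, Cmod_R.
    destruct (HM s) as [HM1 _]; [lra|].
    pose proof (ratio_bound s Hs) as Hr.
    rewrite Rabs_Ropp; unfold Rdiv.
    rewrite !Rabs_mult, (Rabs_pos_eq (ratio s)), (Rabs_pos_eq (/ w));
      [|apply Rlt_le, Rinv_0_lt_compat; lra|lra].
    assert (Hc : Rabs (cos (w * s)) <= 1) by apply Rabs_le, COS_bound.
    pose proof (Rabs_pos (cos (w * s))); pose proof (Cmod_ge_0 (H s)).
    assert (Hi : 0 < / w) by (apply Rinv_0_lt_compat; lra).
    replace (ratio s * Rabs (cos (w * s)) * / w * Cmod (H s))
      with (ratio s * Rabs (cos (w * s)) * Cmod (H s) * / w) by ring.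
    apply Rmult_le_compat_r; [lra|].
    apply Rmult_le_compat; nra. }
  pose proof (is_RInt_C_minus _ _ _ _ _ _ Hl HF) as HD.
  (* 12 M comes from [dratio * H] and 2 M from [ratio * dH]; the boundary terms at 1 and e add 2 M
     each, for a total of 18 M. *)
  assert (HDb : Cmod (l - (F 1%R - F e)) <= 14 * M / w).
  { apply Rle_trans with ((1 - e) * (14 * M / w)).
    2:{ assert (0 <= 14 * M / w); [|nra].
        apply Rmult_le_pos; [lra|apply Rlt_le, Rinv_0_lt_compat; lra]. }
    refine (Cmod_RInt_le _ (fun _ => 14 * M / w) e 1 _ _ _ _ HD _); [lra| |].
    2:{ apply (is_RInt_const (V := R_NormedModule)). }
    intros s Hs; assert (Hsn : 0 < sin (PI / 2 * s)) by (apply sin_half_pos; lra).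
    replace (dirichlet N s * (s ^ 2 * H s) - dF s)%C
      with (RtoC (cos (w * s) / w) * (dratio s * H s + ratio s * dH s))%C.
    - destruct (HM s) as [HM1 HM2]; [lra|].
      rewrite Cmod_mult, Cmod_R; unfold Rdiv.
      rewrite Rabs_mult, (Rabs_pos_eq (/ w)) by (apply Rlt_le, Rinv_0_lt_compat; lra).
      assert (Hc : Rabs (cos (w * s)) <= 1) by apply Rabs_le, COS_bound.
      assert (Hi : 0 < / w) by (apply Rinv_0_lt_compat; lra).
      assert (Hs2 : Cmod (dratio s * H s + ratio s * dH s) <= 14 * M).
      { eapply Rle_trans; [apply Cmod_triangle|].
        rewrite !Cmod_mult, !Cmod_R.
        pose proof (dratio_bound s) as Hd; pose proof (ratio_bound s) as Hr.
        rewrite (Rabs_pos_eq (ratio s)) by (apply Hr; lra).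
        pose proof (Cmod_ge_0 (H s)); pose proof (Cmod_ge_0 (dH s)).
        assert (Rabs (dratio s) * Cmod (H s) <= 12 * M).
        { apply Rmult_le_compat; try assumption; [apply Rabs_pos|apply Hd; lra]. }
        assert (ratio s * Cmod (dH s) <= 2 * M).
        { apply Rmult_le_compat; try assumption; [apply Hr; lra|].
          destruct Hr as [_ Hr]; lra. }
        lra. }
      pose proof (Cmod_ge_0 (dratio s * H s + ratio s * dH s)).
      pose proof (Rabs_pos (cos (w * s))).
      rewrite (Rmult_comm _ (/ w)), (Rmult_comm _ (/ w)), Rmult_assoc.
      apply Rmult_le_compat_l; [lra|nra].
    - unfold dF.
      assert (E : dirichlet N s * s ^ 2 = ratio s * sin (w * s)).
      { unfold w; rewrite <- dirichlet_sin; unfold ratio; field; lra. }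
      rewrite Cmult_assoc.
      replace (RtoC (dirichlet N s) * RtoC s ^ 2)%C with (RtoC (ratio s * sin (w * s))).
      2:{ rewrite <- E, RtoC_mult, RtoC_pow; reflexivity. }
      rewrite RtoC_minus, RtoC_opp.
      replace (RtoC (dratio s * cos (w * s) / w))
        with (RtoC (dratio s) * RtoC (cos (w * s) / w))%C
        by (rewrite <- RtoC_mult; f_equal; field; lra).
      replace (RtoC (ratio s * cos (w * s) / w))
        with (RtoC (ratio s) * RtoC (cos (w * s) / w))%C
        by (rewrite <- RtoC_mult; f_equal; field; lra).
      ring. }
  replace l with ((l - (F 1 - F e)) + (F 1 + - F e))%C by ring.
  eapply Rle_trans; [apply Cmod_triangle|].
  pose proof (Cmod_triangle (F 1) (- F e)) as HT; rewrite Cmod_opp in HT.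
  pose proof (HFb 1); pose proof (HFb e).
  apply Rle_trans with (18 * M / w).
  - replace (18 * M / w) with (14 * M / w + (2 * M / w + 2 * M / w)) by (field; lra); lra.
  - apply Rmult_le_compat_l; [lra|apply Rinv_le_contravar; lra].
Qed.

(** The cut e tends to 0: the integrand is bounded by 2 M on [0, e], so the missing piece costs at
    most 2 M e. *)
Lemma dirichlet_decay (N : nat) (l : C) :
  is_RInt (V := C_R_NormedModule) (fun s => dirichlet N s * (s ^ 2 * H s))%C 0 1 l ->
  Cmod l <= 18 * M / (INR N + / 2).
Proof.
  intros Hl.
  assert (HM0 : 0 <= M).
  { destruct (HM 1) as [HM1 _]; [lra|]; pose proof (Cmod_ge_0 (H 1)); lra. }
  assert (Hcut : forall e, 0 < e < 1 -> Cmod l <= 18 * M / (INR N + / 2) + 2 * M * e).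
  { intros e He.
    assert (Hex : forall u v, exists m,
      is_RInt (V := C_R_NormedModule) (fun s => dirichlet N s * (s ^ 2 * H s))%C u v m).
    { intros u v; apply ex_RInt_Ccontinuous; intros s _.
      apply Ccontinuous_mult; [apply Ccontinuous_RtoC, continuous_dirichlet|].
      apply Ccontinuous_mult; [|eapply is_Cderive_continuous, HdH].
      simpl; apply Ccontinuous_mult; [apply Ccontinuous_RtoC, continuous_id|].
      apply Ccontinuous_mult; [apply Ccontinuous_RtoC, continuous_id|apply Ccontinuous_const]. }
    destruct (Hex 0 e) as [l1 H1]; destruct (Hex e 1) as [l2 H2].
    replace l with (l2 + l1)%C.
    2:{ rewrite Cplus_comm.
        pose proof (is_RInt_Chasles (V := C_R_NormedModule) _ _ _ _ _ _ H1 H2) as H3.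
        assert (E := filterlim_locally_unique _ _ _ Hl H3); now rewrite E. }
    eapply Rle_trans; [apply Cmod_triangle|]; apply Rplus_le_compat.
    - now apply (dirichlet_decay_cut N e).
    - refine (Cmod_RInt_le _ (fun _ => 2 * M) 0 e _ _ _ _ H1 _); [lra| |].
      2:{ evar_last; [apply (is_RInt_const (V := R_NormedModule))|].
          unfold scal; simpl; unfold mult; simpl; ring. }
      intros s Hs; destruct (HM s) as [HM1 _]; [lra|].
      pose proof (Cmod_ge_0 (H s)).
      rewrite Cmult_assoc, <- RtoC_pow, <- RtoC_mult, Cmod_mult, Cmod_R.
      apply Rmult_le_compat; [apply Rabs_pos|assumption| |assumption].
      (* At s = 0 the product formula says nothing about the kernel, but the factor s^2 makes the
         integrand vanish. *)
      destruct (Req_dec s 0) as [->|Hs0].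
      + rewrite pow_i, Rmult_0_r, Rabs_R0 by lia; lra.
      + assert (Hsn : 0 < sin (PI / 2 * s)) by (apply sin_half_pos; lra).
        replace (dirichlet N s * s ^ 2) with (ratio s * sin ((INR N + / 2) * PI * s))
          by (rewrite <- dirichlet_sin; unfold ratio; field; lra).
        pose proof (ratio_bound s) as Hr; rewrite Rabs_mult, (Rabs_pos_eq (ratio s)) by (apply Hr; lra).
        assert (Rabs (sin ((INR N + / 2) * PI * s)) <= 1) by apply Rabs_le, SIN_bound.
        pose proof (Rabs_pos (sin ((INR N + / 2) * PI * s))); nra. }
  apply le_epsilon; intros eps Heps.
  (* The minimum keeps e below 1 while 2 M e <= eps; the [+ 1] allows M = 0. *)
  assert (He : 0 < Rmin (1 / 2) (eps / (2 * M + 1))).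
  { apply Rmin_pos; [lra|apply Rdiv_lt_0_compat; lra]. }
  pose proof (Rmin_l (1 / 2) (eps / (2 * M + 1))).
  pose proof (Rmin_r (1 / 2) (eps / (2 * M + 1))) as Hr.
  set (e := Rmin _ _) in *.
  eapply Rle_trans; [apply (Hcut e); lra|].
  apply Rle_div_r in Hr; nra.
Qed.

End DirichletDecay.

(* Indices run from 1 to N. *)
Fixpoint Csum (u : nat -> C) (N : nat) : C :=
  match N with
  | O => 0%C
  | S n => (Csum u n + u (S n))%C
  end.

Lemma is_RInt_dirichlet (g : R -> C) (c : nat -> C) (l : C) (N : nat) :
  is_RInt (V := C_R_NormedModule) g 0 1 l ->
  (forall k, is_RInt (V := C_R_NormedModule) (fun s => cos (INR k * PI * s) * g s)%C 0 1 (c k)) ->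
  is_RInt (V := C_R_NormedModule) (fun s => dirichlet N s * g s)%C 0 1 (l + Csum c N * 2)%C.
Proof.
  intros Hl Hc; induction N as [|N IH].
  - simpl; replace (l + 0 * 2)%C with l by ring.
    apply (is_RInt_C_ext g); [|exact Hl].
    intros s _; simpl; ring.
  - change (Csum c (S N)) with (Csum c N + c (S N))%C.
    replace (l + (Csum c N + c (S N)) * 2)%C with ((l + Csum c N * 2) + c (S N) * 2)%C by ring.
    apply (is_RInt_C_ext
      (fun s => dirichlet N s * g s + cos (INR (S N) * PI * s) * g s * 2)%C).
    + intros s _; change (dirichlet (S N) s) with (dirichlet N s + 2 * cos (INR (S N) * PI * s)).
      rewrite RtoC_plus, RtoC_mult; ring.
    + apply is_RInt_C_plus; [exact IH|apply is_RInt_C_mult_r, Hc].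
Qed.

(** The kernel has mass one on [0, 1], since cos(k pi s) integrates to 0 for k >= 1. *)
Lemma is_RInt_dirichlet_const (c : C) (N : nat) :
  is_RInt (V := C_R_NormedModule) (fun s => dirichlet N s * c)%C 0 1 c.
Proof.
  pose proof (is_RInt_C_const c 0 1) as H1.
  rewrite Rminus_0_r, Cmult_1_l in H1.
  evar_last.
  (* The coefficients are required for k = 0 as well, where the cosine is 1 and the integral is [c];
     [Csum] starts at index 1, so it sums zeros only. *)
  - apply (is_RInt_dirichlet (fun _ => c) (fun k => match k with O => c | _ => 0%C end) _ N H1).
    intros [|k].
    + apply (is_RInt_C_ext (fun _ => c)); [|exact H1].
      intros s _; simpl; rewrite !Rmult_0_l, cos_0; ring.
    + assert (Hk : INR (S k) * PI <> 0).
      { apply Rmult_integral_contrapositive; split; [apply not_0_INR; lia|apply PI_neq0]. }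
      evar_last.
      * apply (is_RInt_Cderive (fun s => RtoC (sin (INR (S k) * PI * s) / (INR (S k) * PI)) * c)%C).
        -- intros s _; eapply is_Cderive_eq.
           ++ apply is_Cderive_mult; [|apply is_Cderive_const].
              apply is_Cderive_RtoC.
              instantiate (1 := cos (INR (S k) * PI * s)).
              set (K := INR (S k) * PI) in *; auto_derive; [trivial|field; exact Hk].
           ++ rewrite Cmult_0_r; apply Cplus_0_r.
        -- intros s _; apply Ccontinuous_mult; [|apply Ccontinuous_const].
           apply Ccontinuous_RtoC, continuous_cos_lin.
      * rewrite Rmult_0_r, Rmult_1_r, sin_0, sin_INR_PI.
        unfold Rdiv; rewrite Rmult_0_l; ring.
  - assert (E : forall n, Csum (fun k => match k with O => c | _ => 0%C end) n = 0%C).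
    { induction n as [|n IH]; [reflexivity|simpl; rewrite IH; ring]. }
    rewrite E; ring.
Qed.

(** * The case n = 1 *)

Lemma is_RInt_0_oo_criterion (f : R -> C) (l : C) :
  (forall eps, 0 < eps -> exists B, forall b, B < b ->
    exists y, is_RInt (V := C_R_NormedModule) f 0 b y /\ Cmod (y - l) < eps) ->
  is_RInt_0_oo f l.
Proof.
  intros H P [eps HP]; destruct (H eps (cond_pos eps)) as [B HB].
  apply Filter_prod with (fun x => x = 0) (fun b => B < b).
  - reflexivity.
  - now exists B.
  - intros x b -> Hb; destruct (HB b Hb) as [y [Hy Hl]].
    exists y; split; [exact Hy|].
    apply HP, (norm_compat1 (V := C_R_NormedModule)).
    rewrite norm_C_R; exact Hl.
Qed.

(** Up to x0 the phase stays within pi/2, so the real part is at least 1. Beyond x0 the exponential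
    has modulus at most e^(-Re(z) x0) < 1. *)
Lemma Cmod_one_plus_Cexp_lower (z : C) : 0 < Re z ->
  exists m, 0 < m /\ forall x : R, 0 <= x -> m <= Cmod (1 + Cexp (- (z * x))).
Proof.
  intros Hz; pose proof PI_RGT_0 as HP.
  set (y := Rabs (Im z)); assert (Hy : 0 <= y) by apply Rabs_pos.
  (* The [1 +] makes the threshold meaningful for real z. *)
  set (x0 := PI / 2 / (1 + y)).
  assert (Hx0 : 0 < x0) by (apply Rdiv_lt_0_compat; lra).
  assert (Hexp : forall x, 0 < x -> exp (- (Re z * x)) < 1).
  { intros x Hx; rewrite <- exp_0; apply exp_increasing; nra. }
  exists (1 - exp (- (Re z * x0))); split; [pose proof (Hexp x0 Hx0); lra|].
  intros x Hx.
  assert (Hre : Re (- (z * x))%C = - (Re z * x)) by (destruct z; simpl; ring).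
  assert (Him : Im (- (z * x))%C = - (Im z * x)) by (destruct z; simpl; ring).
  destruct (Rle_dec x x0) as [H|H].
  - apply Rle_trans with 1; [pose proof (exp_pos (- (Re z * x0))); lra|].
    eapply Rle_trans; [|apply Re_le_Cmod].
    change (1 <= 1 + exp (Re (- (z * x))%C) * cos (Im (- (z * x))%C)).
    rewrite Him, cos_neg.
    assert (Hyx : Rabs (Im z * x) <= PI / 2).
    { rewrite Rabs_mult, (Rabs_pos_eq x) by exact Hx; fold y.
      apply Rle_trans with ((1 + y) * x0); [nra|].
      unfold x0; right; field; lra. }
    assert (Hc : 0 <= cos (Im z * x)).
    { apply Rabs_le_between in Hyx; apply cos_ge_0; lra. }
    pose proof (exp_pos (Re (- (z * x))%C)); nra.
  - assert (Hw : Cmod (Cexp (- (z * x))) <= exp (- (Re z * x0))).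
    { rewrite Cmod_Cexp, Hre; apply Rlt_le, exp_increasing; nra. }
    pose proof (Cmod_triangle (1 + Cexp (- (z * x))) (- Cexp (- (z * x)))) as HT.
    replace (1 + Cexp (- (z * x)) + - Cexp (- (z * x)))%C with (RtoC 1) in HT by ring.
    rewrite Cmod_opp, Cmod_1 in HT; lra.
Qed.

Lemma is_RInt_id_exp (w b : R) : w <> 0 ->
  is_RInt (fun x => x * exp (- (w * x))) 0 b (/ w ^ 2 - (b / w + / w ^ 2) * exp (- (w * b))).
Proof.
  intros Hw; evar_last.
  - apply (is_RInt_derive (V := R_CompleteNormedModule)
      (fun x => - ((x / w + / w ^ 2) * exp (- (w * x))))).
    + intros x _; auto_derive; [trivial|field; exact Hw].
    + intros x _; apply (ex_derive_continuous (V := R_NormedModule)); auto_derive; trivial.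
  - change (- ((b / w + / w ^ 2) * exp (- (w * b))) - - ((0 / w + / w ^ 2) * exp (- (w * 0)))
      = / w ^ 2 - (b / w + / w ^ 2) * exp (- (w * b))).
    rewrite Rmult_0_r, Ropp_0, exp_0; field; exact Hw.
Qed.

(** Used twice: to bound the denominator away from 0 when n = 1, and to split the integrand into
    partial fractions for general n. *)
Lemma cosh_plus_cos_factor (z : C) (y : R) :
  (2 * (Ccosh z + cos y))%C
  = (Cexp z * ((1 + Cexp (- z + Ci * y)) * (1 + Cexp (- z + - (Ci * y)))))%C.
Proof.
  rewrite !Cexp_plus.
  pose proof (Cexp_opp_r z) as E1; pose proof (Cexp_opp_r (Ci * y)) as E2.
  pose proof (cos_Cexp y) as E3; rewrite RtoC_mult in E3.
  unfold Ccosh.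
  transitivity (Cexp z + Cexp (- z) + 2 * cos y)%C; [field|rewrite E3].
  set (A := Cexp z) in *; set (B := Cexp (- z)) in *.
  set (U := Cexp (Ci * y)) in *; set (V := Cexp (- (Ci * y))) in *.
  transitivity (A + (A * B) * (U + V) + (A * B) * B * (U * V))%C; [rewrite E1, E2|]; ring.
Qed.

Section BaseCase.

Variable a : C.
Hypothesis Ha : 0 < Re a.

Definition denom (x : R) : C := (Ccosh (a * x) + cos x)%C.

Lemma denom_factor (x : R) :
  (2 * denom x)%C = (Cexp (a * x) * ((1 + Cexp (- ((a - Ci) * x))) * (1 + Cexp (- ((a + Ci) * x)))))%C.
Proof.
  replace (- ((a - Ci) * x))%C with (- (a * x) + Ci * x)%C by ring.
  replace (- ((a + Ci) * x))%C with (- (a * x) + - (Ci * x))%C by ring.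
  apply cosh_plus_cos_factor.
Qed.

(** Both a - i and a + i have positive real part, so the two factors are bounded below, and e^(a x)
    has modulus at least 1. *)
Lemma denom_inv_bound : exists K, forall x, 0 <= x -> denom x <> 0%C /\ Cmod (/ denom x) <= K.
Proof.
  destruct (Cmod_one_plus_Cexp_lower (a - Ci)) as [m1 [Hm1 H1]];
    [destruct a; simpl in *; lra|].
  destruct (Cmod_one_plus_Cexp_lower (a + Ci)) as [m2 [Hm2 H2]];
    [destruct a; simpl in *; lra|].
  exists (/ (m1 * m2 / 2)); intros x Hx.
  assert (HD : m1 * m2 / 2 <= Cmod (denom x)).
  { pose proof (f_equal Cmod (denom_factor x)) as E; rewrite !Cmod_mult, Cmod_Cexp in E.
    rewrite Cmod_R, Rabs_pos_eq in E by lra.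
    replace (Re (a * x)%C) with (Re a * x) in E by (destruct a; simpl; ring).
    assert (He : 1 <= exp (Re a * x)).
    { rewrite <- exp_0 at 1; destruct (Req_dec x 0) as [->|];
        [right; f_equal; ring|apply Rlt_le, exp_increasing; nra]. }
    pose proof (H1 x Hx) as H3; pose proof (H2 x Hx) as H4.
    assert (m1 * m2 <= Cmod (1 + Cexp (- ((a - Ci) * x))) * Cmod (1 + Cexp (- ((a + Ci) * x))))
      by (apply Rmult_le_compat; lra).
    assert (0 < m1 * m2) by nra.
    assert (1 * (m1 * m2) <= exp (Re a * x) * (Cmod (1 + Cexp (- ((a - Ci) * x)))
      * Cmod (1 + Cexp (- ((a + Ci) * x))))) by (apply Rmult_le_compat; lra).
    lra. }
  assert (Hp : 0 < m1 * m2 / 2) by nra.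
  assert (H0 : denom x <> 0%C).
  { intros E; rewrite E, Cmod_0 in HD; lra. }
  split; [exact H0|].
  rewrite Cmod_inv by exact H0; now apply Rinv_le_contravar.
Qed.

(* The integrand for n = 1 with its singularity at PI removed. *)
Definition reg (x : R) : C := (- rho 1 x / denom x)%C.

Lemma integrand_reg (x : R) : 0 <= x -> x <> PI -> reg x = integrand 1 a x.
Proof.
  intros Hx Hpi; unfold reg, integrand, denom.
  rewrite rho_closed by assumption; simpl INR; rewrite Rmult_1_l.
  replace ((-1) ^ 1 * sin x * (x / (x ^ 2 - PI ^ 2)))
    with (- (sin x * (x / (x ^ 2 - PI ^ 2)))) by ring.
  rewrite RtoC_opp, RtoC_mult; unfold Cdiv; ring.
Qed.

Lemma Ccontinuous_denom (x : R) : Ccontinuous denom x.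
Proof.
  assert (Hl : Ccontinuous (fun x => a * x)%C x).
  { apply Ccontinuous_mult; [apply Ccontinuous_const|apply Ccontinuous_RtoC, continuous_id]. }
  apply Ccontinuous_plus; [|apply Ccontinuous_RtoC, continuous_cos].
  apply Ccontinuous_mult; [|apply Ccontinuous_const].
  apply Ccontinuous_plus; apply Ccontinuous_Cexp; [exact Hl|].
  apply Ccontinuous_opp, Hl.
Qed.

Lemma Ccontinuous_reg (x : R) : 0 <= x -> Ccontinuous reg x.
Proof.
  intros Hx; destruct denom_inv_bound as [K HK].
  apply Ccontinuous_mult.
  - apply Ccontinuous_opp, Ccontinuous_RtoC, continuous_rho.
  - apply Ccontinuous_inv; [apply Ccontinuous_denom|apply HK, Hx].
Qed.

(** Integrals agree as soon as integrands agree on the open interval, so splitting at [PI] removes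
    the one point where [reg] and [integrand] may differ. *)
Lemma is_RInt_integrand (b : R) : PI < b ->
  exists y, is_RInt (V := C_R_NormedModule) (integrand 1 a) 0 b y
    /\ is_RInt (V := C_R_NormedModule) reg 0 b y.
Proof.
  intros Hb; pose proof PI_RGT_0 as HP.
  destruct (ex_RInt_Ccontinuous reg 0 PI) as [y1 H1].
  { rewrite Rmin_left by lra; intros x Hx; apply Ccontinuous_reg; lra. }
  destruct (ex_RInt_Ccontinuous reg PI b) as [y2 H2].
  { rewrite Rmin_left by lra; intros x Hx; apply Ccontinuous_reg; lra. }
  exists (y1 + y2)%C; split; apply (is_RInt_Chasles (V := C_R_NormedModule)) with PI;
    try assumption.
  - apply (is_RInt_C_ext reg); [|exact H1].
    rewrite Rmin_left, Rmax_right by lra; intros x Hx; apply integrand_reg; lra.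
  - apply (is_RInt_C_ext reg); [|exact H2].
    rewrite Rmin_left, Rmax_right by lra; intros x Hx; apply integrand_reg; lra.
Qed.

(* The tail of the geometric series after N terms, in closed form. *)
Definition remainder (N : nat) (x : R) : C :=
  ((expw a (S N) x * rho N x - expw a N x * rho (S N) x) / denom x)%C.

Lemma expw_S (k : nat) (x : R) : expw a (S k) x = (expw a k x * Cexp (- (a * x)))%C.
Proof.
  unfold expw; rewrite <- Cexp_plus; f_equal; rewrite S_INR, RtoC_plus; ring.
Qed.

(** Induction on N. The step expands 2 [denom] as e^(a x) + e^(-a x) + 2 cos x and eliminates
    rho_(N+2) by [rho_rec]; the case N = 0 uses rho_0 = 0. *)
Lemma remainder_eq (N : nat) (x : R) : 0 <= x ->
  remainder N x = (reg x + Csum (fun k => expw a k x * rho k x) N * 2)%C.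
Proof.
  intros Hx; destruct denom_inv_bound as [K HK]; destruct (HK x Hx) as [H0 _].
  induction N as [|N IH].
  - unfold remainder, reg; simpl; rewrite rho_0.
    replace (expw a 0 x) with (RtoC 1); [unfold Cdiv; ring|].
    unfold expw; simpl; rewrite <- Cexp_RtoC_0; f_equal; ring.
  - simpl Csum; rewrite Cmult_plus_distr_r, Cplus_assoc, <- IH.
    unfold remainder; rewrite (expw_S (S N)).
    replace (expw a N x) with (expw a (S N) x * Cexp (a * x))%C.
    2:{ rewrite expw_S, <- Cmult_assoc, (Cmult_comm (Cexp (- _))), Cexp_opp_r; ring. }
    set (w := expw a (S N) x).
    assert (Hr : RtoC (rho (S (S N)) x) = (- rho N x - 2 * cos x * rho (S N) x)%C).
    { rewrite <- !RtoC_mult, <- RtoC_opp, <- RtoC_minus; f_equal.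
      pose proof (rho_rec N x Hx); lra. }
    rewrite Hr.
    transitivity ((w * rho N x - w * Cexp (a * x) * rho (S N) x
      + (w * rho (S N) x * 2) * denom x) / denom x)%C.
    + apply (f_equal (fun z => z / denom x)%C); unfold denom, Ccosh; field.
    + field; exact H0.
Qed.

(** The constant does not depend on N, and x e^(-N Re(a) x) has integral at most 1 / (N Re a)^2 for
    N >= 1, so the integrated remainder is O(1/N). *)
Lemma Cmod_remainder : exists K, forall N x, 0 <= x ->
  Cmod (remainder N x) <= K * (INR N + 1) * (x * exp (- (INR N * Re a * x))).
Proof.
  destruct denom_inv_bound as [K HK]; exists (2 * K); intros N x Hx.
  destruct (HK x Hx) as [_ HKx].
  assert (Hw : forall k, Cmod (expw a k x) = exp (- (INR k * Re a * x))).
  { intros k; unfold expw; rewrite Cmod_Cexp; f_equal; destruct a; simpl; ring. }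
  set (e := exp (- (INR N * Re a * x))).
  assert (He : exp (- (INR (S N) * Re a * x)) <= e).
  { rewrite S_INR; unfold e.
    destruct (Req_dec x 0) as [->|]; [right; f_equal; ring|].
    apply Rlt_le, exp_increasing; nra. }
  pose proof (pos_INR N) as HN.
  unfold remainder, Cdiv; rewrite Cmod_mult.
  replace (2 * K * (INR N + 1) * (x * e)) with ((2 * (INR N + 1) * x * e) * K) by ring.
  apply Rmult_le_compat; try apply Cmod_ge_0; [|exact HKx].
  eapply Rle_trans; [apply Cmod_triangle|].
  rewrite Cmod_opp, !Cmod_mult, !Hw, !Cmod_R; fold e.
  pose proof (rho_bound N x Hx) as R1; pose proof (rho_bound (S N) x Hx) as R2.
  rewrite S_INR in R2.
  pose proof (Rabs_pos (rho N x)); pose proof (Rabs_pos (rho (S N) x)).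
  pose proof (exp_pos (- (INR (S N) * Re a * x))).
  assert (exp (- (INR (S N) * Re a * x)) * Rabs (rho N x) <= e * ((INR N + 1) * x)).
  { apply Rmult_le_compat; nra. }
  assert (e * Rabs (rho (S N) x) <= e * ((INR N + 1) * x)).
  { apply Rmult_le_compat_l; [apply Rlt_le, exp_pos|exact R2]. }
  lra.
Qed.

(** All indices are at least 1, so each of the N truncation errors is at most the bound for k = 1.
    The total tends to 0 as b grows with N fixed. *)
Lemma is_RInt_Csum (c : nat -> C) (b : R) (N : nat) : 0 <= b ->
  (forall k, is_RInt (V := C_R_NormedModule) (fun s => cos (INR k * PI * s) * gfun a s)%C 0 1 (c k)) ->
  exists l, is_RInt (V := C_R_NormedModule)
      (fun x => Csum (fun k => expw a k x * rho k x)%C N) 0 b l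
    /\ Cmod (l - Csum c N) <= INR N * (exp (- (Re a * b)) / Re a).
Proof.
  intros Hb Hc; induction N as [|N [l [Hl HN]]].
  - exists (RtoC 0); split.
    + evar_last; [apply (is_RInt_C_const (RtoC 0))|apply Cmult_0_r].
    + simpl; replace (0 - 0)%C with (RtoC 0) by ring; rewrite Cmod_0; lra.
  - destruct (is_RInt_expw_rho a Ha (S N) b (c (S N)) (Hc _)) as [m [Hm HmN]].
    exists (l + m)%C; split; [now apply is_RInt_C_plus|].
    simpl Csum.
    replace (l + m - (Csum c N + c (S N)))%C with ((l - Csum c N) + (m - c (S N)))%C by ring.
    eapply Rle_trans; [apply Cmod_triangle|].
    rewrite (S_INR N), Rmult_plus_distr_r, Rmult_1_l.
    apply Rplus_le_compat; [exact HN|].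
    eapply Rle_trans; [exact HmN|].
    apply Rmult_le_compat_r; [apply Rlt_le, Rinv_0_lt_compat, Ha|].
    rewrite S_INR; pose proof (pos_INR N).
    assert (Hle : - ((INR N + 1) * Re a * b) <= - (Re a * b)).
    { assert (0 <= Re a * b) by (apply Rmult_le_pos; lra); nra. }
    destruct Hle as [Hlt|Heq]; [apply Rlt_le, exp_increasing, Hlt|rewrite Heq; lra].
Qed.

(** The partial Fourier sum at 0 is the integral of g against the Dirichlet kernel. As the kernel
    has mass one, subtracting g(0) = 1/a leaves the kernel against g - g(0), to which
    [dirichlet_decay] applies. *)
Lemma gfun_dirichlet_limit (c : nat -> C) (l : C) :
  (forall k, is_RInt (V := C_R_NormedModule) (fun s => cos (INR k * PI * s) * gfun a s)%C 0 1 (c k)) ->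
  is_RInt (V := C_R_NormedModule) (gfun a) 0 1 l ->
  exists K, forall N, Cmod (l + Csum c N * 2 - / a) <= K / (INR N + / 2).
Proof.
  intros Hc Hl.
  assert (Ha0 : a <> 0%C) by now apply Re_pos_neq_0.
  set (q := fun s : R => (a * a + s * s)%C).
  assert (Hq : forall s, q s <> 0%C) by (intros; now apply sqr_plus_sqr_neq_0).
  (* The quotient (g(s) - g(0)) / s^2 in closed form. *)
  set (H := fun s : R => (- / a * / q s)%C).
  set (dH := fun s : R => (- / a * (- (2 * s) / (q s * q s)))%C).
  assert (Hdq : forall s : R, is_Cderive q s (2 * s)%C).
  { intros s; eapply is_Cderive_eq.
    - apply is_Cderive_plus; [apply is_Cderive_const|].
      apply is_Cderive_mult; apply (is_Cderive_RtoC (fun s => s)), (is_derive_id (K := R_AbsRing)).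
    - change (0 + (1 * s + s * 1) = 2 * s)%C; ring. }
  assert (HdH : forall s, is_Cderive H s (dH s)).
  { intros s; eapply is_Cderive_eq.
    - apply is_Cderive_mult; [apply is_Cderive_const|].
      apply is_Cderive_inv; [apply Hdq|apply Hq].
    - unfold dH; ring. }
  assert (Hcq : forall s, Ccontinuous q s).
  { intros s; eapply is_Cderive_continuous, Hdq. }
  assert (HcdH : forall s, Ccontinuous dH s).
  { intros s; apply Ccontinuous_mult; [apply Ccontinuous_const|].
    apply Ccontinuous_mult.
    - apply Ccontinuous_opp, Ccontinuous_mult; [apply Ccontinuous_const|].
      apply Ccontinuous_RtoC, continuous_id.
    - apply Ccontinuous_inv; [now apply Ccontinuous_mult|now apply Cmult_neq_0]. }
  set (p := / Re a); assert (Hp : 0 < p) by (apply Rinv_0_lt_compat, Ha).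
  assert (Hia : Cmod (/ a) <= p) by (apply (Cmod_inv_le a Ha), Re_le_Cmod).
  assert (Hiq : forall s, Cmod (/ q s) <= p * p).
  { intros s; unfold q; rewrite sqr_plus_sqr_factor.
    pose proof (am_neq_0 a Ha s); pose proof (ap_neq_0 a Ha s).
    replace (/ ((a - Ci * s) * (a + Ci * s)))%C with (/ (a - Ci * s) * / (a + Ci * s))%C
      by (field; split; assumption).
    rewrite Cmod_mult; apply Rmult_le_compat; try apply Cmod_ge_0; apply (Cmod_inv_le a Ha).
    - rewrite <- (Re_minus_Ci a s); apply Re_le_Cmod.
    - rewrite <- (Re_plus_Ci a s); apply Re_le_Cmod. }
  (* The sum of a bound for H and a bound for its derivative, from |1/a| <= p, |1/q| <= p^2 and 2 s
     <= 2. *)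
  set (M := p * (p * p) + p * (2 * ((p * p) * (p * p)))).
  assert (Hpp : 0 < p * p) by nra.
  assert (HM : forall s, 0 <= s <= 1 -> Cmod (H s) <= M /\ Cmod (dH s) <= M).
  { intros s Hs; pose proof (Hiq s) as Hi; pose proof (Cmod_ge_0 (/ q s)) as Hi0.
    pose proof (Cmod_ge_0 (/ a)) as Ha1.
    assert (0 < p * (p * p)) by nra.
    assert (0 < (p * p) * (p * p)) by nra.
    assert (0 < p * (2 * ((p * p) * (p * p)))) by nra.
    split.
    - unfold H; rewrite Cmod_mult, Cmod_opp.
      apply Rle_trans with (p * (p * p)); [|unfold M; lra].
      apply Rmult_le_compat; assumption.
    - unfold dH, Cdiv.
      replace (/ (q s * q s))%C with (/ q s * / q s)%C by (field; apply Hq).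
      rewrite !Cmod_mult, !Cmod_opp, Cmod_mult, !Cmod_R, (Rabs_pos_eq 2), (Rabs_pos_eq s) by lra.
      apply Rle_trans with (p * (2 * ((p * p) * (p * p)))); [|unfold M; lra].
      apply Rmult_le_compat; try assumption.
      { apply Rmult_le_pos; [lra|nra]. }
      apply Rmult_le_compat; [lra|nra|lra|].
      apply Rmult_le_compat; assumption. }
  exists (18 * M); intros N.
  apply (dirichlet_decay H dH M HdH HcdH HM N).
  apply (is_RInt_C_ext (fun s => dirichlet N s * gfun a s - dirichlet N s * / a)%C).
  - intros s _; unfold H, gfun; fold (q s).
    replace (RtoC s ^ 2)%C with (q s - a * a)%C by (unfold q; simpl; ring).
    field; split; [apply Hq|exact Ha0].
  - apply is_RInt_C_minus; [now apply is_RInt_dirichlet|apply is_RInt_dirichlet_const].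
Qed.

Lemma exp_opp_lt_inv (t : R) : 0 < t -> exp (- t) < / t.
Proof.
  intros Ht; rewrite exp_Ropp.
  apply Rinv_lt_contravar; [apply Rmult_lt_0_compat; [exact Ht|apply exp_pos]|].
  pose proof (exp_ineq1 t); lra.
Qed.

Lemma is_RInt_0_oo_integrand_1 (l : C) :
  is_RInt (V := C_R_NormedModule) (gfun a) 0 1 l ->
  is_RInt_0_oo (integrand 1 a) (l - / a)%C.
Proof.
  intros Hl; apply is_RInt_0_oo_criterion; intros eps Heps.
  assert (Hc : exists c : nat -> C, forall k,
    is_RInt (V := C_R_NormedModule) (fun s => cos (INR k * PI * s) * gfun a s)%C 0 1 (c k)).
  { eexists (fun k => (_, _)); intros k.
    apply (is_RInt_Ccontinuous (fun s => cos (INR k * PI * s) * gfun a s)%C).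
    intros s _; now apply Ccontinuous_cos_gfun. }
  destruct Hc as [c Hc].
  destruct (gfun_dirichlet_limit c l Hc Hl) as [K1 HK1].
  destruct Cmod_remainder as [K2 HK2].
  set (p := Re a) in *.
  (* T / N dominates the Fourier error and the integrated remainder together. Absolute values are
     taken because [K1] and [K2] come without a sign. *)
  set (T := Rabs K1 + 2 * Rabs K2 / p ^ 2).
  assert (HT : 0 <= T).
  { apply Rplus_le_le_0_compat; [apply Rabs_pos|].
    apply Rmult_le_pos; [pose proof (Rabs_pos K2); lra|].
    apply Rlt_le, Rinv_0_lt_compat; nra. }
  destruct (INR_unbounded (2 * T / eps)) as [N0 HN0].
  (* The successor ensures N >= 1, which gives N + 1 <= 2 N below. *)
  set (N := S N0).
  assert (HN : 1 <= INR N) by (unfold N; rewrite S_INR; pose proof (pos_INR N0); lra).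
  assert (HTN : T / INR N < eps / 2).
  { apply Rlt_div_l; [lra|].
    assert (2 * T / eps < INR N) by (unfold N; rewrite S_INR; lra).
    apply Rlt_div_l in H; lra. }
  (* By e^(-t) < 1/t, twice the truncation error is below 2 N / (p^2 b), and this is below eps / 2
     past the second bound. *)
  exists (Rmax PI (4 * INR N / (p ^ 2 * eps))); intros b Hb.
  assert (Hb1 : PI < b) by (eapply Rle_lt_trans; [apply Rmax_l|exact Hb]).
  assert (Hb2 : 4 * INR N / (p ^ 2 * eps) < b) by (eapply Rle_lt_trans; [apply Rmax_r|exact Hb]).
  pose proof PI_RGT_0 as HP.
  destruct (is_RInt_integrand b Hb1) as [y [Hy1 Hy2]].
  exists y; split; [exact Hy1|].
  destruct (is_RInt_Csum c b N) as [m [Hm1 Hm2]]; [lra|exact Hc|].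
  fold p in Hm2.
  pose proof (is_RInt_C_plus _ _ _ _ _ _ Hy2 (is_RInt_C_mult_r _ 2 _ _ _ Hm1)) as Hr.
  assert (Hrem : Cmod (y + m * 2) <= Rabs K2 * (INR N + 1) * / (INR N * p) ^ 2).
  { apply Rle_trans with (Rabs K2 * (INR N + 1) *
      (/ (INR N * p) ^ 2 - (b / (INR N * p) + / (INR N * p) ^ 2) * exp (- (INR N * p * b)))).
    - refine (Cmod_RInt_le _ (fun x => Rabs K2 * (INR N + 1) * (x * exp (- (INR N * p * x))))
        0 b _ _ _ _ Hr _); [lra| |].
      + intros x Hx; rewrite <- remainder_eq by lra.
        eapply Rle_trans; [apply HK2; lra|].
        apply Rmult_le_compat_r; [apply Rmult_le_pos; [lra|apply Rlt_le, exp_pos]|].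
        apply Rmult_le_compat_r; [lra|apply Rle_abs].
      + apply (is_RInt_scal (V := R_NormedModule)), is_RInt_id_exp; nra.
    - apply Rmult_le_compat_l; [apply Rmult_le_pos; [apply Rabs_pos|lra]|].
      assert (0 <= (b / (INR N * p) + / (INR N * p) ^ 2) * exp (- (INR N * p * b))); [|lra].
      assert (0 < INR N * p) by (apply Rmult_lt_0_compat; lra).
      apply Rmult_le_pos; [|apply Rlt_le, exp_pos].
      apply Rplus_le_le_0_compat.
      + apply Rlt_le, Rdiv_lt_0_compat; lra.
      + apply Rlt_le, Rinv_0_lt_compat; nra. }
  assert (HS : Cmod (m - Csum c N) * 2 < eps / 2).
  { apply Rle_lt_trans with (INR N * (exp (- (p * b)) / p) * 2); [lra|].
    assert (Hpb : 0 < p * b) by nra.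
    pose proof (exp_opp_lt_inv (p * b) Hpb) as He.
    apply Rlt_trans with (INR N * (/ (p * b) / p) * 2).
    - apply Rmult_lt_compat_r; [lra|].
      apply Rmult_lt_compat_l; [lra|].
      apply Rmult_lt_compat_r; [apply Rinv_0_lt_compat, Ha|exact He].
    - assert (Hp2 : 0 < p ^ 2) by (apply pow_lt, Ha).
      apply Rlt_div_l in Hb2; [|now apply Rmult_lt_0_compat].
      replace (INR N * (/ (p * b) / p) * 2) with (2 * INR N / (p ^ 2 * b))
        by (field; split; lra).
      apply Rlt_div_l; [apply Rmult_lt_0_compat; lra|].
      replace (eps / 2 * (p ^ 2 * b)) with (b * (p ^ 2 * eps) / 2) by field; lra. }
  specialize (HK1 N).
  (* Three errors: integrated remainder, truncation at b, Fourier series. *)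
  replace (y - (l - / a))%C
    with ((y + m * 2) + (- ((m - Csum c N) * 2) + - (l + Csum c N * 2 - / a)))%C by ring.
  eapply Rle_lt_trans; [apply Cmod_triangle|].
  eapply Rle_lt_trans; [apply Rplus_le_compat_l, Cmod_triangle|].
  rewrite !Cmod_opp, Cmod_mult, Cmod_R, (Rabs_pos_eq 2) by lra.
  assert (Hfin : Rabs K2 * (INR N + 1) * / (INR N * p) ^ 2 + K1 / (INR N + / 2) <= T / INR N).
  { unfold T; rewrite Rdiv_plus_distr, Rplus_comm; apply Rplus_le_compat.
    - apply Rle_trans with (Rabs K1 / (INR N + / 2)).
      + apply Rmult_le_compat_r; [apply Rlt_le, Rinv_0_lt_compat; lra|apply Rle_abs].
      + apply Rmult_le_compat_l; [apply Rabs_pos|apply Rinv_le_contravar; lra].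
    - apply Rle_trans with (Rabs K2 * (2 * INR N) * / (INR N * p) ^ 2).
      + apply Rmult_le_compat_r; [apply Rlt_le, Rinv_0_lt_compat, pow_lt, Rmult_lt_0_compat; lra|].
        apply Rmult_le_compat_l; [apply Rabs_pos|lra].
      + right; field; split; lra. }
  lra.
Qed.

End BaseCase.

(** * Logarithms and telescoping *)

(** A logarithm for the right half-plane whose argument is an arctangent; unlike [Carg] it has no
    case distinction and is easy to differentiate. *)
Definition Clog_right (z : C) : C := (ln (Cmod z), atan (Im z / Re z)).

Lemma is_Cderive_Clog_right (a : C) (c s : R) : 0 < Re a ->
  is_Cderive (fun s : R => Clog_right (a + Ci * (c * s)%R)) s (c * Ci / (a + Ci * (c * s)%R))%C.
Proof.
  intros Ha; destruct a as [p q]; simpl in Ha.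
  set (w := fun s => q + c * s).
  assert (Hz : forall s, ((p, q) + Ci * (c * s)%R)%C = (p, w s))
    by (intros t; unfold w; apply C_ext; simpl; ring).
  assert (Hpos : 0 < p ^ 2 + w s ^ 2).
  { pose proof (pow_lt p 2 Ha); pose proof (pow2_ge_0 (w s)); lra. }
  rewrite Hz.
  replace (c * Ci / (p, w s))%C
    with (c * w s / (p ^ 2 + w s ^ 2), c * p / (p ^ 2 + w s ^ 2))
    by (apply C_ext; simpl; field; simpl in Hpos; lra).
  split.
  - apply is_derive_ext with (fun s => ln (sqrt (p ^ 2 + w s ^ 2))).
    { intros t; rewrite Hz; reflexivity. }
    assert (Hs : 0 < sqrt (p ^ 2 + w s ^ 2)) by now apply sqrt_lt_R0.
    pose proof (pow2_sqrt _ (Rlt_le _ _ Hpos)) as E.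
    unfold w in *; auto_derive.
    + repeat split; simpl in Hpos, Hs; assumption.
    + set (r := sqrt _) in *.
      transitivity (c * (q + c * s) / r ^ 2).
      * field; lra.
      * rewrite E; reflexivity.
  - apply is_derive_ext with (fun s => atan (w s / p)).
    { intros t; rewrite Hz; reflexivity. }
    unfold w in *; auto_derive; [lra|].
    simpl Im; field; simpl in Hpos |- *; split; lra.
Qed.

Lemma is_RInt_gfun (a : C) : 0 < Re a ->
  is_RInt (V := C_R_NormedModule) (gfun a) 0 1
    ((Clog_right (a + Ci) - Clog_right (a - Ci)) / (2 * Ci))%C.
Proof.
  intros Ha.
  assert (Hi : Ci <> 0%C).
  { intros E; apply (f_equal Im) in E; simpl in E; lra. }
  assert (Em : RtoC (-1) = (- (1))%C) by (apply C_ext; simpl; ring).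
  evar_last.
  - apply (is_RInt_Cderive (fun s : R =>
      (Clog_right (a + Ci * (1 * s)%R) + - Clog_right (a + Ci * (-1 * s)%R)) * / (2 * Ci))%C).
    + intros s _; eapply is_Cderive_eq.
      * apply is_Cderive_mult; [|apply is_Cderive_const].
        apply is_Cderive_plus; [|apply is_Cderive_opp]; now apply is_Cderive_Clog_right.
      * rewrite (gfun_split a Ha).
        pose proof (am_neq_0 a Ha s) as Hm; pose proof (ap_neq_0 a Ha s) as Hp.
        replace (a + Ci * (1 * s)%R)%C with (a + Ci * s)%C by (rewrite Rmult_1_l; reflexivity).
        replace (a + Ci * (-1 * s)%R)%C with (a - Ci * s)%C
          by (rewrite RtoC_mult, Em; ring).
        rewrite Em; field; repeat split; assumption.
    + intros s _.
      (* For k = 0 the cosine factor is 1. *)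
      pose proof (Ccontinuous_cos_gfun a Ha 0 s) as [H1 H2].
      split; [revert H1|revert H2]; apply continuous_ext; intros t; simpl INR;
        rewrite !Rmult_0_l, cos_0, Cmult_1_l; reflexivity.
  - cbv beta; replace (a + Ci * (1 * 1)%R)%C with (a + Ci)%C by (rewrite Rmult_1_r; ring).
    replace (a + Ci * (-1 * 1)%R)%C with (a - Ci)%C by (rewrite Rmult_1_r, Em; ring).
    rewrite !Rmult_0_r; unfold Cdiv; ring.
Qed.

Lemma Clog_right_polar (z : C) : 0 < Re z ->
  z = (Cmod z * Cexp (Ci * atan (Im z / Re z)))%C.
Proof.
  intros Hz; rewrite Cexp_Ci, cos_atan, sin_atan.
  destruct z as [p q]; simpl in Hz; unfold Re, Im; simpl fst; simpl snd.
  assert (E : Cmod (p, q) = p * sqrt (1 + Rsqr (q / p))).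
  { unfold Cmod; simpl.
    replace (p * (p * 1) + q * (q * 1)) with (p ^ 2 * (1 + Rsqr (q / p)))
      by (unfold Rsqr; field; lra).
    rewrite sqrt_mult_alt by nra; rewrite sqrt_pow2 by lra; reflexivity. }
  assert (Hs : 0 < sqrt (1 + Rsqr (q / p))).
  { apply sqrt_lt_R0; pose proof (Rle_0_sqr (q / p)); lra. }
  rewrite E; apply C_ext; simpl; unfold Re, Im; simpl; field; split; lra.
Qed.

Lemma Clog_polar (r t : R) : 0 < r -> - PI < t <= PI ->
  Clog (r * Cexp (Ci * t)) = (ln r, t).
Proof.
  intros Hr Ht; unfold Clog.
  assert (Hm : Cmod (r * Cexp (Ci * t)) = r).
  { rewrite Cmod_mult, Cmod_R, Cmod_Cexp, Rabs_pos_eq by lra.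
    replace (Re (Ci * t)%C) with 0 by (simpl; ring); rewrite exp_0; ring. }
  rewrite Hm; f_equal; unfold Carg; rewrite Hm, Cexp_Ci.
  replace (Re (r * (cos t + Ci * sin t))%C) with (r * cos t) by (simpl; ring).
  replace (Im (r * (cos t + Ci * sin t))%C) with (r * sin t) by (simpl; ring).
  replace (r * cos t / r) with (cos t) by (field; lra).
  destruct (Rle_dec 0 (r * sin t)) as [H|H].
  - apply acos_cos; split; [|lra].
    destruct (Rle_lt_dec 0 t) as [H0|H0]; [exact H0|].
    pose proof (sin_gt_0 (- t)) as Hs; rewrite sin_neg in Hs.
    assert (0 < - sin t) by (apply Hs; lra); nra.
  - rewrite <- cos_neg, acos_cos; [ring|].
    split; [|lra].
    destruct (Rle_lt_dec t 0) as [H0|H0]; [lra|].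
    exfalso; apply H, Rmult_le_pos; [lra|]; apply sin_ge_0; lra.
Qed.

(** Both arguments lie in (-pi/2, pi/2), so their difference lies in (-pi, pi) and no multiple of 2
    pi enters the principal value. *)
Lemma Clog_div_right (u v : C) : 0 < Re u -> 0 < Re v ->
  Clog (u / v) = (Clog_right u - Clog_right v)%C.
Proof.
  intros Hu Hv.
  assert (Hmu : 0 < Cmod u) by (pose proof (Re_le_Cmod u); lra).
  assert (Hmv : 0 < Cmod v) by (pose proof (Re_le_Cmod v); lra).
  pose proof (Clog_right_polar u Hu) as Eu; pose proof (Clog_right_polar v Hv) as Ev.
  unfold Clog_right.
  pose proof (atan_bound (Im u / Re u)); pose proof (atan_bound (Im v / Re v)).
  set (tu := atan (Im u / Re u)) in *; set (tv := atan (Im v / Re v)) in *.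
  replace (u / v)%C with ((Cmod u / Cmod v)%R * Cexp (Ci * (tu - tv)%R))%C.
  - rewrite Clog_polar; [|now apply Rdiv_lt_0_compat|lra].
    rewrite ln_div by assumption; apply C_ext; simpl; ring.
  - rewrite Eu, Ev at 2; rewrite RtoC_div, RtoC_minus by lra.
    replace (Ci * (tu - tv))%C with (Ci * tu + - (Ci * tv))%C by ring.
    rewrite Cexp_plus.
    pose proof (Cexp_opp_r (Ci * tv)) as E; pose proof (Cexp_neq_0 (Ci * tv)).
    assert (RtoC (Cmod v) <> 0%C).
    { intros E0; apply (f_equal Re) in E0; simpl in E0; lra. }
    transitivity (Cmod u * Cexp (Ci * tu) / (Cmod v * Cexp (Ci * tv))
      * (Cexp (Ci * tv) * Cexp (- (Ci * tv))))%C.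
    + field; split; assumption.
    + rewrite E; field; split; assumption.
Qed.

(** Here 1 +- i t/a = (a +- i t)/a is a quotient of points of the right half-plane; the two copies
    of [Clog_right a] cancel. *)
Lemma Catan_div (t : R) (a : C) : 0 < Re a ->
  Catan (t / a) = ((Clog_right (a + Ci * t) - Clog_right (a - Ci * t)) / (2 * Ci))%C.
Proof.
  intros Ha; unfold Catan.
  pose proof (Re_pos_neq_0 a Ha).
  replace (1 + Ci * (t / a))%C with ((a + Ci * t) / a)%C by (field; assumption).
  replace (1 - Ci * (t / a))%C with ((a - Ci * t) / a)%C by (field; assumption).
  rewrite !Clog_div_right by (try rewrite Re_plus_Ci; try rewrite Re_minus_Ci; assumption).
  f_equal; ring.
Qed.

(** * Reduction of general n to n = 1 *)

Definition fermi (z : C) (x : R) : C := (/ (1 + Cexp (- (z * x))))%C.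

Lemma fermi_denom_neq_0 (z : C) (x : R) : 0 < Re z -> 0 <= x ->
  (1 + Cexp (- (z * x)))%C <> 0%C.
Proof.
  intros Hz Hx E; destruct (Cmod_one_plus_Cexp_lower z Hz) as [m [Hm H]].
  specialize (H x Hx); rewrite E, Cmod_0 in H; lra.
Qed.

(** The rational factor is common to both sides, so x = [PI] needs no exclusion. *)
Lemma integrand_fermi (n : nat) (a : C) (x : R) : 0 < Re a -> 0 <= x ->
  integrand n a x = (Ci * (fermi (a - Ci * INR n) x - fermi (a + Ci * INR n) x)
                     * (x / (x ^ 2 - PI ^ 2))%R)%C.
Proof.
  intros Ha Hx; unfold integrand; f_equal; unfold fermi.
  pose proof (fermi_denom_neq_0 (a - Ci * INR n) x) as Hm.
  pose proof (fermi_denom_neq_0 (a + Ci * INR n) x) as Hp.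
  rewrite Re_minus_Ci in Hm; rewrite Re_plus_Ci in Hp.
  specialize (Hm Ha Hx); specialize (Hp Ha Hx).
  pose proof (cosh_plus_cos_factor (a * x) (INR n * x)) as E.
  replace (- ((a - Ci * INR n) * x))%C with (- (a * x) + Ci * (INR n * x)%R)%C in *
    by (rewrite RtoC_mult; ring).
  replace (- ((a + Ci * INR n) * x))%C with (- (a * x) + - (Ci * (INR n * x)%R))%C in *
    by (rewrite RtoC_mult; ring).
  set (D := (Ccosh (a * x) + cos (INR n * x))%C) in *.
  pose proof (Cexp_opp_r (a * x)) as EA.
  assert (ES : (2 * Ci * sin (INR n * x))%C
    = (Cexp (Ci * (INR n * x)%R) - Cexp (- (Ci * (INR n * x)%R)))%C).
  { replace (- (Ci * (INR n * x)%R))%C with (Ci * (- (INR n * x))%R)%C by (rewrite RtoC_opp; ring).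
    rewrite !Cexp_Ci, cos_neg, sin_neg, RtoC_opp; ring. }
  rewrite !Cexp_plus in *.
  set (A := Cexp (a * x)) in *; set (B := Cexp (- (a * x))) in *.
  set (U := Cexp (Ci * (INR n * x)%R)) in *; set (V := Cexp (- (Ci * (INR n * x)%R))) in *.
  assert (HA : A <> 0%C) by apply Cexp_neq_0.
  assert (H2 : (2 * D)%C <> 0%C) by (rewrite E; repeat apply Cmult_neq_0; assumption).
  assert (HD : D <> 0%C) by (intros E0; apply H2; rewrite E0; ring).
  transitivity (2 * sin (INR n * x) / (2 * D))%C; [field; exact HD|rewrite E].
  (* Inserting A B = 1 and -i i = 1 exposes B (U - V), the numerator of the difference of the two
     fractions. *)
  transitivity (- Ci * (A * B) * (2 * Ci * sin (INR n * x)) / (A * ((1 + B * U) * (1 + B * V))))%C.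
  - rewrite EA; replace (- Ci * 1 * (2 * Ci * sin (INR n * x)))%C
      with (- (Ci * Ci) * (2 * sin (INR n * x)))%C by ring.
    replace (- (Ci * Ci))%C with (RtoC 1) by (apply C_ext; simpl; ring).
    rewrite Cmult_1_l; reflexivity.
  - rewrite ES; field; repeat split; assumption.
Qed.

Lemma is_RInt_0_oo_plus (f g : R -> C) (l m : C) :
  is_RInt_0_oo f l -> is_RInt_0_oo g m -> is_RInt_0_oo (fun x => f x + g x)%C (l + m)%C.
Proof.
  unfold is_RInt_0_oo; intros Hf Hg.
  exact (is_RInt_gen_plus (V := C_R_NormedModule) f g l m Hf Hg).
Qed.

Lemma is_RInt_0_oo_ext (f g : R -> C) (l : C) :
  (forall x, 0 < x -> f x = g x) -> is_RInt_0_oo f l -> is_RInt_0_oo g l.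
Proof.
  unfold is_RInt_0_oo; intros H.
  refine (is_RInt_gen_ext (V := C_R_NormedModule) f g l _).
  apply Filter_prod with (fun x => x = 0) (fun b => 0 < b).
  - reflexivity.
  - now exists 0.
  - intros x b -> Hb y; simpl; rewrite Rmin_left, Rmax_right by lra.
    intros Hy; apply H; lra.
Qed.

(** Each step of 2i adds one integrand with n = 1. Its logarithms telescope, while its term 1/c
    accumulates in the sum. *)
Lemma is_RInt_0_oo_fermi (a : C) (u : R) (m : nat) : 0 < Re a ->
  is_RInt_0_oo
    (fun x => Ci * (fermi (a + Ci * u) x - fermi (a + Ci * (u + 2 * INR m)%R) x)
              * (x / (x ^ 2 - PI ^ 2))%R)%C
    ((Clog_right (a + Ci * (u + 2 * INR m)%R) - Clog_right (a + Ci * u)) / (2 * Ci)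
     - Csum (fun j => / (a + Ci * (u + 2 * INR j - 1)%R)) m)%C.
Proof.
  intros Ha; induction m as [|m IH].
  - simpl; rewrite Rmult_0_r, Rplus_0_r.
    replace ((_ - _) / _ - 0)%C with (RtoC 0) by (unfold Cdiv; ring).
    apply (is_RInt_0_oo_ext (fun _ => RtoC 0)); [intros; ring|].
    apply is_RInt_0_oo_criterion; intros eps Heps; exists 0; intros b _.
    exists (RtoC 0); split.
    + evar_last; [apply (is_RInt_C_const (RtoC 0))|apply Cmult_0_r].
    + replace (0 - 0)%C with (RtoC 0) by ring; now rewrite Cmod_0.
  (* The midpoint of the new step, whose endpoints are c - i and c + i. *)
  - set (c := (a + Ci * (u + 2 * INR m + 1)%R)%C).
    assert (Hc : 0 < Re c) by (unfold c; now rewrite Re_plus_Ci).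
    pose proof (is_RInt_0_oo_integrand_1 c Hc _ (is_RInt_gfun c Hc)) as H1.
    pose proof (is_RInt_0_oo_plus _ _ _ _ IH H1) as H.
    assert (E1 : (c - Ci)%C = (a + Ci * (u + 2 * INR m)%R)%C)
      by (unfold c; rewrite !RtoC_plus; ring).
    assert (E2 : (c + Ci)%C = (a + Ci * (u + 2 * INR (S m))%R)%C)
      by (unfold c; rewrite S_INR, !RtoC_plus, !RtoC_mult, RtoC_plus; ring).
    assert (E3 : c = (a + Ci * (u + 2 * INR (S m) - 1)%R)%C)
      by (unfold c; do 3 f_equal; rewrite S_INR; ring).
    rewrite <- E1 in *; rewrite <- E2.
    cbn [Csum]; rewrite <- E3.
    replace (_ / _ - (_ + _))%C with
      ((Clog_right (c - Ci) - Clog_right (a + Ci * u)) / (2 * Ci) -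
       Csum (fun j : nat => / (a + Ci * (u + 2 * INR j - 1)%R)) m +
       ((Clog_right (c + Ci) - Clog_right (c - Ci)) / (2 * Ci) - / c))%C
      by (unfold Cdiv; ring).
    revert H; apply is_RInt_0_oo_ext; intros x Hx.
    rewrite (integrand_fermi 1 c) by lra; simpl INR; rewrite Cmult_1_r; ring.
Qed.

Lemma is_RInt_0_oo_integrand (n : nat) (a : C) : 0 < Re a ->
  is_RInt_0_oo (integrand n a)
    (Catan (INR n / a) - Csum (fun j => / (a + Ci * (2 * INR j - 1 - INR n)%R)) n)%C.
Proof.
  intros Ha.
  pose proof (is_RInt_0_oo_fermi a (- INR n) n Ha) as H.
  rewrite Catan_div by exact Ha.
  replace (- INR n + 2 * INR n) with (INR n) in H by ring.
  replace (a + Ci * (- INR n)%R)%C with (a - Ci * INR n)%C in H by (rewrite RtoC_opp; ring).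
  assert (E : forall m, Csum (fun j => / (a + Ci * (- INR n + 2 * INR j - 1)%R))%C m
    = Csum (fun j => / (a + Ci * (2 * INR j - 1 - INR n)%R))%C m).
  { induction m as [|m IH]; [reflexivity|].
    simpl Csum; rewrite IH; do 5 f_equal; ring. }
  rewrite E in H; revert H; apply is_RInt_0_oo_ext; intros x Hx.
  symmetry; apply integrand_fermi; [exact Ha|lra].
Qed.

Theorem mainTheorem10 :
  forall a : C, 0 < Re a ->
    is_RInt_0_oo (integrand 2 a)
      (Catan (2 / a) - 2 * a / (1 + a ^ 2))%C
    /\
    is_RInt_0_oo (integrand 3 a)
      (Catan (3 / a) - (4 + 3 * a ^ 2) / (a * (4 + a ^ 2)))%C
    /\
    is_RInt_0_oo (integrand 4 a)
      (Catan (4 / a) - 4 * a * (5 + a ^ 2) / (9 + 10 * a ^ 2 + a ^ 4))%C.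
Proof.
  intros a Ha.
  pose proof (is_RInt_0_oo_integrand 2 a Ha) as H2.
  pose proof (is_RInt_0_oo_integrand 3 a Ha) as H3.
  pose proof (is_RInt_0_oo_integrand 4 a Ha) as H4.
  (* The shifts are symmetric about 0, so the terms pair into 2 a / (a^2 + r^2): r = 1 for n = 2, r
     = 2 with an unpaired 1/a for n = 3, r = 1 and 3 for n = 4. *)
  assert (Hpair : forall r : R, (/ (a + Ci * (- r)%R) + / (a + Ci * r))%C = (2 * gfun a r)%C).
  { intros r; rewrite (gfun_split a Ha), RtoC_opp.
    pose proof (am_neq_0 a Ha r); pose proof (ap_neq_0 a Ha r).
    replace (a + Ci * - r)%C with (a - Ci * r)%C by ring; field; split; assumption. }
  pose proof (Re_pos_neq_0 a Ha) as Ha0.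
  assert (N1 : (a * a + 1)%C <> 0%C).
  { replace (a * a + 1)%C with (a * a + 1 * 1)%C by ring; now apply sqr_plus_sqr_neq_0. }
  assert (N2 : (a * a + 4)%C <> 0%C).
  { replace (a * a + 4)%C with (a * a + 2 * 2)%C by ring; now apply sqr_plus_sqr_neq_0. }
  assert (N3 : (a * a + 9)%C <> 0%C).
  { replace (a * a + 9)%C with (a * a + 3 * 3)%C by ring; now apply sqr_plus_sqr_neq_0. }
  pose proof (Hpair 1) as P1; pose proof (Hpair 2) as P2; pose proof (Hpair 3) as P3.
  unfold gfun in P1, P2, P3.
  split; [|split].
  - evar_last; [exact H2|]; simpl INR; cbn [Csum]; simpl INR.
    replace (2 * 1 - 1 - (1 + 1)) with (- (1)) by ring.
    replace (2 * (1 + 1) - 1 - (1 + 1)) with 1 by ring.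
    replace (1 + 1) with 2 by ring.
    f_equal; rewrite Cplus_0_l, P1.
    replace (1 + a ^ 2)%C with (a * a + 1 * 1)%C by (simpl; ring).
    unfold Cdiv; ring.
  - evar_last; [exact H3|]; simpl INR; cbn [Csum]; simpl INR.
    replace (2 * 1 - 1 - (1 + 1 + 1)) with (- (2)) by ring.
    replace (2 * (1 + 1) - 1 - (1 + 1 + 1)) with 0 by ring.
    replace (2 * (1 + 1 + 1) - 1 - (1 + 1 + 1)) with 2 by ring.
    replace (1 + 1 + 1) with 3 by ring.
    f_equal; rewrite Cmult_0_r, Cplus_0_r, Cplus_0_l.
    transitivity (/ a + (/ (a + Ci * (- (2))%R) + / (a + Ci * 2)))%C; [ring|rewrite P2].
    replace (4 + a ^ 2)%C with (a * a + 2 * 2)%C by (simpl; ring).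
    field; split; assumption.
  - evar_last; [exact H4|]; simpl INR; cbn [Csum]; simpl INR.
    replace (2 * 1 - 1 - (1 + 1 + 1 + 1)) with (- (3)) by ring.
    replace (2 * (1 + 1) - 1 - (1 + 1 + 1 + 1)) with (- (1)) by ring.
    replace (2 * (1 + 1 + 1) - 1 - (1 + 1 + 1 + 1)) with 1 by ring.
    replace (2 * (1 + 1 + 1 + 1) - 1 - (1 + 1 + 1 + 1)) with 3 by ring.
    replace (1 + 1 + 1 + 1) with 4 by ring.
    f_equal; rewrite Cplus_0_l.
    transitivity ((/ (a + Ci * (- (1))%R) + / (a + Ci * 1))
      + (/ (a + Ci * (- (3))%R) + / (a + Ci * 3)))%C; [ring|rewrite P1, P3].
    replace (9 + 10 * a ^ 2 + a ^ 4)%C with ((a * a + 1 * 1) * (a * a + 3 * 3))%C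
      by (simpl; ring).
    field; split; assumption.
Qed.
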